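(* Let $\Bbbk$ be an algebraically closed field with $\operatorname{char}\Bbbk>0$. Let $Y\subset\mathbb{P}^{N'}$ and $Z\subset\mathbb{P}^{N''}$ be projectively embedded toric varieties. If $n:=\dim(Y)+\dim(Z)$ is greater than or equal to $N'$, then there exists an $n$-dimensional projectively embedded toric variety $X\subset\mathbb{P}^{n+N''}$ satisfying the following conditions: (i) (The closure of) a general fiber of the Gauss map $\gamma$ of $X$ with the reduced structure is projectively equivalent to $Y$. (ii) (The closure of) the image of $\gamma$ is projectively equivalent to $Z$.
   Context: For a free abelian group $M$ of finite rank, $T_M=\operatorname{Spec}\Bbbk[M]$, where $\Bbbk[M]=\bigoplus_{u\in M}\Bbbk z^u$. For a finite subset $A=\{u_0,\ldots,u_N\}\subset M$ (distinct elements), $X_A\subset\mathbb{P}^N$ is the closure of the image of $T_M\to\mathbb{P}^N$, $t\mapsto[z^{u_0}(t):\cdots:z^{u_N}(t)]$. A projective variety $X\subset\mathbb{P}^N$ is called projectively embedded toric if it is projectively equivalent to $X_A$ for some finite subset $A$ of a free abelian group $M$ of finite rank. Here $X_1\subset\mathbb{P}^{N_1}$ and $X_2\subset\mathbb{P}^{N_2}$ are projectively equivalent if there are linear embeddings $\jmath_i:\mathbb{P}^{N_i}\hookrightarrow\mathbb{P}^{m}$ (i.e. $\jmath_i^*\mathcal{O}(1)=\mathcal{O}(1)$) for some $m$ with $\jmath_1(X_1)=\jmath_2(X_2)$. The Gauss map of an $n$-dimensional projective variety $X\subset\mathbb{P}^N$ is the rational map $\gamma: X\dashrightarrow\mathbb{G}(n,\mathbb{P}^N)$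 sending each smooth point $x$ to the embedded tangent space $\mathbb{T}_xX\subset\mathbb{P}^N$. Closures of fibers are taken in $X$; the closure of the image of $\gamma$ is regarded as a projective variety via the Plücker embedding of the Grassmannian. *)

(* Defs.v *)
From mathcomp Require Import all_boot all_order all_algebra.
From mathcomp Require Import mpoly.

Set Implicit Arguments.
Unset Strict Implicit.
Unset Printing Implicit Defensive.

Import GRing.Theory.
Local Open Scope ring_scope.

Section ProjectiveSpace.

Variable k : closedFieldType.

(* Projective space with r homogeneous coordinates (that is, P^(r-1)) is handled
   through its homogeneous coordinate vectors: a point is a nonzero x : 'rV_r up
   to scaling, and a subset is a predicate on vectors.  Every set that is
   [closed] below consists of nonzero vectors and is stable under nonzero
   scaling, so it is exactly a closed subset of projective space. *)
Definition pset (r : nat) := 'rV[k]_r -> Prop.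

Definition sub_pset r (X1 X2 : pset r) := forall x, X1 x -> X2 x.

Definition eq_pset r (X1 X2 : pset r) := forall x, X1 x <-> X2 x.

Definition homogeneous r (F : {mpoly k[r]}) := exists d : nat, F \is d.-homog.

Definition zeros r (S : {mpoly k[r]} -> Prop) : pset r :=
  fun x => x != 0 /\ forall F, S F -> F.@[x 0] = 0.

Definition closed r (X : pset r) :=
  exists S : {mpoly k[r]} -> Prop,
    (forall F, S F -> homogeneous F) /\ eq_pset X (zeros S).

(* The homogeneous elements of the ideal I(X). *)
Definition hideal r (X : pset r) : {mpoly k[r]} -> Prop :=
  fun F => homogeneous F /\ forall x, X x -> F.@[x 0] = 0.

Definition zclosure r (X : pset r) : pset r := zeros (hideal X).

Definition irreducible r (X : pset r) :=
  (exists x, X x) /\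
  forall C1 C2 : pset r, closed C1 -> closed C2 ->
    (forall x, X x -> C1 x \/ C2 x) -> sub_pset X C1 \/ sub_pset X C2.

Definition projective_variety r (X : pset r) := closed X /\ irreducible X.

(* C 0 < C 1 < ... < C d, a chain of irreducible closed subsets of X. *)
Definition irreducible_chain r (X : pset r) (d : nat) (C : nat -> pset r) :=
  (forall i, (i <= d)%N ->
     [/\ closed (C i), irreducible (C i) & sub_pset (C i) X]) /\
  (forall i, (i < d)%N -> sub_pset (C i) (C i.+1) /\ ~ sub_pset (C i.+1) (C i)).

(* Krull dimension; chains can be truncated, so it is enough to exclude d.+1. *)
Definition has_dim r (X : pset r) (d : nat) :=
  (exists C, irreducible_chain X d C) /\
  ~ (exists C, irreducible_chain X d.+1 C).

(* Linear embeddings P^(r1-1) -> P^m and P^(r2-1) -> P^m are given by injective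
   matrices J1 and J2 acting on row vectors. *)
Definition projectively_equivalent r1 r2 (X1 : pset r1) (X2 : pset r2) :=
  exists (m : nat) (J1 : 'M[k]_(r1, m.+1)) (J2 : 'M[k]_(r2, m.+1)),
    [/\ row_free J1, row_free J2 &
        eq_pset (fun y => exists2 x, X1 x & y = x *m J1)
                 (fun y => exists2 x, X2 x & y = x *m J2)].

(* P holds at a general point of V, i.e. on a nonempty open subset of V. *)
Definition for_general_point r (V P : pset r) :=
  exists C : pset r,
    [/\ closed C, exists2 x, V x & ~ C x & forall x, V x -> ~ C x -> P x].

End ProjectiveSpace.

Section Toric.

Variable k : closedFieldType.

Definition free_of_finite_rank (M : zmodType) :=
  exists (m : nat) (f : {additive M -> 'rV[int]_m}), bijective f.

(* A closed point of T_M = Spec k[M] is a k-algebra morphism k[M] -> k, i.e. a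
   monoid morphism t from M to the multiplicative monoid of k, and z^u(t) is
   then t u.  Note that t u is invertible, with inverse t (- u). *)
Definition torus_point (M : zmodType) (t : M -> k) :=
  t 0 = 1 /\ forall u v, t (u + v) = t u * t v.

Definition toric (M : zmodType) (N : nat) (A : 'I_N.+1 -> M) : pset k N.+1 :=
  zclosure (fun x => exists2 t, torus_point t & x = \row_i t (A i)).

Definition projectively_embedded_toric r (X : pset k r) :=
  projective_variety X /\
  exists (M : zmodType) (N : nat) (A : 'I_N.+1 -> M),
    [/\ free_of_finite_rank M, injective A &
        projectively_equivalent X (toric A)].

End Toric.

Section GaussMap.

Variable k : closedFieldType.

(* The linear subspace P(U) is the embedded tangent space T_x X.  By Euler's
   formula x itself belongs to U. *)
Definition embedded_tangent_space r (X : pset k r) (x : 'rV[k]_r)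
    (U : {vspace 'rV[k]_r}) :=
  forall v : 'rV[k]_r,
    v \in U <->
    (forall F, hideal X F -> \sum_(i < r) (F^`M(i)).@[x 0] * v 0 i = 0).

(* x is a smooth point of the n-dimensional variety X, and T_x X = P(U); as
   P(U) has dimension \dim U - 1, smoothness of x reads \dim U = n.+1. *)
Definition gauss n r (X : pset k r) (x : 'rV[k]_r) (U : {vspace 'rV[k]_r}) :=
  [/\ X x, embedded_tangent_space X x U & \dim U = n.+1].

(* Pluecker coordinates are indexed by the increasing maps 'I_d -> 'I_r. *)
Definition increasing_map (d r : nat) :=
  {f : {ffun 'I_d -> 'I_r} |
     [forall i : 'I_d, forall j : 'I_d, (i < j)%N ==> (f i < f j)%N]}.

Definition pluecker_size d r := #|{: increasing_map d r}|.

(* Meaningful when \dim U = d: the maximal minors of a d x r matrix whose rows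
   form a basis of U. *)
Definition pluecker d r (U : {vspace 'rV[k]_r}) : 'rV[k]_(pluecker_size d r) :=
  \row_j \det (\matrix_(a < d, b < d)
                 (vbasis U)`_a 0 (val (enum_val j : increasing_map d r) b)).

(* gamma(x) is defined and is the point w in the Pluecker embedding. *)
Definition gauss_map n r (X : pset k r) (x : 'rV[k]_r)
    (w : 'rV[k]_(pluecker_size n.+1 r)) :=
  exists U, gauss n X x U /\ exists2 c : k, c != 0 & w = c *: pluecker n.+1 U.

Definition gauss_image n r (X : pset k r) : pset k (pluecker_size n.+1 r) :=
  fun w => exists x, gauss_map X x w.

Definition gauss_fiber n r (X : pset k r) (w : 'rV[k]_(pluecker_size n.+1 r)) :
    pset k r :=
  fun x => gauss_map X x w.

End GaussMap.

Arguments gauss_map {k} n {r} X x w.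
Arguments gauss_fiber {k} n {r} X w _.
Arguments gauss_image {k} n {r} X _.

(* Main.v *)
From mathcomp Require Import all_boot all_order all_algebra.
From mathcomp Require Import perm mpoly zify ring.
From Stdlib Require Import Classical.
Require Import Defs.

(** Write [Y] and [Z] as closures of the images of monomial maps [s |-> (s^a_i)]
    and [t |-> (t^c_j)], with [a_0 = c_0 = 0] and with exponents that generate the
    lattices of rank [dY] and [dZ] ([toric_normal_form], by the Smith normal
    form). The variety [X] is the closure of the set of points [(y, xi)]
    parametrized by the torus of pairs [(s, t)]. The second block [xi] is the
    point of [Z] of parameter [t^p]. The first block [y] consists of [n = dY + dZ]
    monomials whose exponent matrix [u] has a determinant prime to [p] and whose
    restrictions to the first factor are the nonzero [a_i], completed by zeros
    ([minor_choice]); there is room for them because the independence of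
    characters bounds their number by [N' <= n].

    At a point of the torus, the coordinates of [xi] are p-th powers and have zero
    derivatives, while those of [y] are local coordinates. So the tangent space is
    spanned by the first block and [xi] ([gauss_frob_point]). Its Pluecker
    coordinates are those of [xi] up to a linear embedding ([pluecker_join]).
    Hence the image of the Gauss map is [Z], as Frobenius is bijective, and the
    fiber through the point of parameters [(s, t)] is obtained by letting [s] vary;
    its coordinates are constant multiples of the [s^a_i], which gives [Y]
    ([fiber_equiv]).

    The smooth points outside the torus need care, both for the image and for the
    fibers. Near a smooth point the Gauss map is given by a vector of forms
    ([gauss_local]); therefore forms vanishing on the image of the torus vanish on
    the whole image ([gauss_image_closure]). For the fibers, a form vanishing on
    the fiber of the torus over one value of [t] is transported to all values of
    [t] by the action of the torus. After raising to the power [p] the transported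
    form depends polynomially on the point, by way of the local vector of forms,
    so it vanishes on all of [X] ([gauss_fiber_closure]).

    Dimensions are computed by comparing growth rates: a chain of irreducible
    closed sets of length [d] produces about [e^d] independent forms of degree [e]
    ([chain_growth]), whereas the forms on an orbit of an [m]-dimensional torus
    are combinations of about [e^m] characters
    ([forms_independent_torus_orbit]). A chain of the expected length is given by
    subtori ([torus_orbit_chain]). *)

Set Implicit Arguments.
Unset Strict Implicit.
Unset Printing Implicit Defensive.

Import GRing.Theory.
Local Open Scope ring_scope.

(** * Forms, closures and linear equivalence of projective sets *)

Section Forms.

Variable k : closedFieldType.

(** Forms are handled as functions of the homogeneous coordinates, which makes
    substitutions such as [form_comp] immediate; a polynomial is chosen only
    where its partial derivatives are needed. *)
Definition form r d (f : 'rV[k]_r -> k) :=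
  exists2 F : {mpoly k[r]}, F \is d.-homog & forall x, f x = F.@[x 0].

Lemma form_ext r d (f g : 'rV[k]_r -> k) : f =1 g -> form d f -> form d g.
Proof. by move=> fg [F hF fF]; exists F => // x; rewrite -fg. Qed.

Lemma form_poly r d (F : {mpoly k[r]}) :
  F \is d.-homog -> form d (fun x => F.@[x 0]).
Proof. by move=> hF; exists F. Qed.

Lemma form_const r c : form 0 (fun _ : 'rV[k]_r => c).
Proof.
exists c%:MP => [|x]; last by rewrite mevalC.
by rewrite -[c%:MP]mulr1 mul_mpolyC dhomogZ // dhomog1.
Qed.

Lemma form_coord r i : form 1 (fun x : 'rV[k]_r => x 0 i).
Proof.
exists 'X_i => [|x]; last by rewrite mevalXU.
by rewrite dhomogX /= mdeg1.
Qed.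

Lemma form_zero r d : form d (fun _ : 'rV[k]_r => 0).
Proof. by exists 0 => [|x]; [exact: dhomog0|rewrite meval0]. Qed.

Lemma form_add r d (f g : 'rV[k]_r -> k) :
  form d f -> form d g -> form d (fun x => f x + g x).
Proof.
move=> [F hF fF] [G hG gG]; exists (F + G); first exact: dhomogD.
by move=> x; rewrite mevalD fF gG.
Qed.

Lemma form_mul r d e (f g : 'rV[k]_r -> k) :
  form d f -> form e g -> form (d + e) (fun x => f x * g x).
Proof.
move=> [F hF fF] [G hG gG]; exists (F * G); first exact: dhomogM.
by move=> x; rewrite mevalM fF gG.
Qed.

Lemma form_scale r d c (f : 'rV[k]_r -> k) :
  form d f -> form d (fun x => c * f x).
Proof. by move=> hf; rewrite -[d]add0n; apply: form_mul (form_const _ _) hf. Qed.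

Lemma form_sum r d (I : Type) (s : seq I) (P : pred I) (f : I -> 'rV[k]_r -> k) :
  (forall i, P i -> form d (f i)) -> form d (fun x => \sum_(i <- s | P i) f i x).
Proof.
move=> hf; elim: s => [|i s IH].
  by apply: form_ext (form_zero _ d) => x; rewrite big_nil.
have [Pi|/negbTE nPi] := boolP (P i); last first.
  by apply: form_ext IH => x; rewrite big_cons nPi.
by apply: form_ext (form_add (hf i Pi) IH) => x; rewrite big_cons Pi.
Qed.

Lemma form_exp r d (f : 'rV[k]_r -> k) n :
  form d f -> form (d * n) (fun x => f x ^+ n).
Proof.
move=> hf; elim: n => [|n IH].
  by rewrite muln0; apply: form_ext (form_const _ 1).
rewrite mulnS; apply: form_ext (form_mul hf IH) => x.
by rewrite exprS.
Qed.

Lemma form_prod r (I : Type) (s : seq I) (d : I -> nat) (f : I -> 'rV[k]_r -> k) :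
  (forall i, form (d i) (f i)) ->
  form (\sum_(i <- s) d i)%N (fun x => \prod_(i <- s) f i x).
Proof.
move=> hf; elim: s => [|i s IH].
  by rewrite big_nil; apply: form_ext (form_const _ 1) => x; rewrite big_nil.
by rewrite big_cons; apply: form_ext (form_mul (hf i) IH) => x; rewrite big_cons.
Qed.

Lemma form_lin r q (G : 'M[k]_(r, q)) j : form 1 (fun x => (x *m G) 0 j).
Proof.
have h i : form 1 (fun x : 'rV[k]_r => G i j * x 0 i).
  exact/form_scale/form_coord.
apply: form_ext (form_sum (index_enum _) (P := xpredT) (fun i _ => h i)) => x.
by rewrite mxE; apply: eq_bigr => i _; rewrite mulrC.
Qed.

(** Expand [f] into monomials: a product of [d] forms of degree [e] is a form of
    degree [e * d]. *)
Lemma form_comp r q d e (f : 'rV[k]_q -> k) (g : 'rV[k]_r -> 'rV[k]_q) :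
  form d f -> (forall i, form e (fun x => g x 0 i)) -> form (e * d) (fun x => f (g x)).
Proof.
move=> [F hF fF] hg.
pose h m x : k := F@_m * \prod_(i < q) g x 0 i ^+ m i.
have hh m : m \in msupp F -> form (e * d) (h m).
  move=> mF; apply: form_scale.
  have <- : (\sum_i m i)%N = d by rewrite -mdegE; apply: (dhomogP _ _ _ hF _ mF).
  rewrite big_distrr /=.
  by apply: form_prod => i; apply: form_exp.
apply: form_ext (form_sum (msupp F) hh) => x.
by rewrite fF mevalE [RHS]big_seq.
Qed.

Lemma form_pull r q d (f : 'rV[k]_q -> k) (G : 'M[k]_(r, q)) :
  form d f -> form d (fun x => f (x *m G)).
Proof. by move=> hf; rewrite -[d]mul1n; apply: form_comp => // i; apply: form_lin. Qed.

Lemma form_homogeneous r d (f : 'rV[k]_r -> k) c x :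
  form d f -> f (c *: x) = c ^+ d * f x.
Proof.
move=> [F hF fF]; rewrite !fF !mevalE big_distrr /=.
rewrite big_seq [RHS]big_seq; apply: eq_bigr => m mF.
rewrite mulrCA; congr (_ * _).
have <- : (\sum_i m i)%N = d by rewrite -mdegE; apply: (dhomogP _ _ _ hF _ mF).
rewrite -prodrXr -big_split /=.
by apply: eq_bigr => i _; rewrite mxE exprMn.
Qed.

Lemma zclosureP r (S : pset k r) x :
  zclosure S x <-> x != 0 /\
    forall d f, form d f -> (forall y, S y -> f y = 0) -> f x = 0.
Proof.
split=> [[x0 hx]|[x0 hx]]; split=> //.
  move=> d f [F hF fF] fS; rewrite fF; apply: hx; split; first by exists d.
  by move=> y /fS; rewrite fF.
by move=> F [[d hF] FS]; apply: (hx d (fun x => F.@[x 0])) => //; apply: form_poly.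
Qed.

Lemma zclosure_nz r (S : pset k r) x : zclosure S x -> x != 0.
Proof. by case. Qed.

Lemma zclosure_form r (S : pset k r) d f x : form d f ->
  (forall y, S y -> f y = 0) -> zclosure S x -> f x = 0.
Proof. by move=> hf fS /zclosureP[_ /(_ d f)]; apply. Qed.

Lemma sub_zclosure r (S : pset k r) x : x != 0 -> S x -> zclosure S x.
Proof. by move=> x0 Sx; apply/zclosureP; split=> // d f _; apply. Qed.

Lemma zclosure_closed r (S : pset k r) : closed (zclosure S).
Proof. by exists (hideal S); split=> // F []. Qed.

Lemma closed_zclosure r (X : pset k r) : closed X -> eq_pset X (zclosure X).
Proof.
move=> [S [hS XS]] x; split=> [Xx|[x0 hx]].
  by apply: sub_zclosure => //; case/XS: Xx.
by apply/XS; split=> // F SF; apply: hx; split; [exact: hS|move=> y /XS[_]; apply].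
Qed.

Lemma closed_nz r (X : pset k r) x : closed X -> X x -> x != 0.
Proof. by move=> cX Xx; case: (proj1 (closed_zclosure cX x) Xx). Qed.

Lemma zclosure_min r (S X : pset k r) :
  closed X -> sub_pset S X -> sub_pset (zclosure S) X.
Proof.
move=> cX SX x hx; apply/(closed_zclosure cX x)/zclosureP; split.
  exact: zclosure_nz hx.
by move=> d f hf fX; apply: (zclosure_form hf _ hx) => y /SX; apply: fX.
Qed.

(** A form vanishes at a point if and only if it vanishes at its nonzero
    multiples, so a closure only sees points up to scaling. *)
Lemma zclosure_scale r (S S' : pset k r) :
  (forall x, S x -> exists2 c, c != 0 & S' (c *: x)) ->
  sub_pset (zclosure S) (zclosure S').
Proof.
move=> SS' x hx; apply/zclosureP; split; first exact: zclosure_nz hx.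
move=> d f hf fS'; apply: (zclosure_form hf _ hx) => y /SS'[c c0 /fS'].
rewrite (form_homogeneous _ _ hf) => /eqP.
by rewrite mulf_eq0 expf_eq0 (negbTE c0) andbF => /eqP.
Qed.

Lemma zclosure_sub r (S T : pset k r) :
  sub_pset S T -> sub_pset (zclosure S) (zclosure T).
Proof.
move=> s; apply: zclosure_scale => x /s Tx; exists 1; first exact: oner_neq0.
by rewrite scale1r.
Qed.

Lemma notin_closed r (C : pset k r) x : closed C -> ~ C x -> x != 0 ->
  exists d f, [/\ form d f, forall y, C y -> f y = 0 & f x != 0].
Proof.
move=> cC nCx x0; apply: NNPP => hn; apply: nCx; apply/(closed_zclosure cC x)/zclosureP.
split=> // d f hf fC; apply/eqP/negPn/negP => fx; apply: hn.
by exists d, f.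
Qed.

Lemma closed_form r d (f : 'rV[k]_r -> k) : form d f ->
  closed (fun x => x != 0 /\ f x = 0).
Proof.
move=> [F hF fF]; exists (fun G => G = F); split=> [G ->|x]; first by exists d.
by split=> [] [x0 h]; split=> //; [move=> G ->; rewrite -fF | rewrite fF; apply: h].
Qed.

Lemma closed_pull r q (X : pset k r) (Y : pset k q) (G : 'M[k]_(r, q)) :
  closed X -> closed Y -> (forall x, X x -> x *m G != 0) ->
  closed (fun x => X x /\ Y (x *m G)).
Proof.
move=> cX cY h.
suff e : eq_pset (fun x => X x /\ Y (x *m G)) (zclosure (fun x => X x /\ Y (x *m G))).
  have [S [hS XS]] := @zclosure_closed _ (fun x => X x /\ Y (x *m G)).
  by exists S; split=> // x; rewrite e.
move=> x; split=> [[Xx Yx]|hx].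
  by apply: sub_zclosure; [exact: closed_nz Xx|].
have Xx : X x by apply: zclosure_min hx => // y [].
split=> //; apply/(closed_zclosure cY (x *m G))/zclosureP; split; first exact: h.
move=> d f hf fY; apply: (zclosure_form (form_pull G hf) _ hx).
by move=> y [_]; apply: fY.
Qed.

Lemma irreducible_zclosure r (S : pset k r) :
  (forall x, S x -> x != 0) -> irreducible S -> irreducible (zclosure S).
Proof.
move=> S0 [[x Sx] hS]; split; first by exists x; apply: sub_zclosure => //; apply: S0.
move=> C1 C2 c1 c2 h.
case: (hS C1 C2 c1 c2) => [y Sy|h1|h2].
- by apply: h; apply: sub_zclosure => //; apply: S0.
- by left; apply: zclosure_min.
- by right; apply: zclosure_min.
Qed.

(** Mutually inverse linear substitutions, only required to be inverse to each
    other on the two sets. This relation is visibly symmetric and transitive,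
    and it agrees with projective equivalence by [projectively_equivalent_lin]
    and [lin_projectively_equivalent]. *)
Definition linearly_equivalent r q (X : pset k r) (Y : pset k q) :=
  exists (G : 'M[k]_(r, q)) (H : 'M[k]_(q, r)),
    (forall x, X x -> Y (x *m G) /\ x *m G *m H = x) /\
    (forall y, Y y -> X (y *m H) /\ y *m H *m G = y).

Lemma linearly_equivalent_sym r q (X : pset k r) (Y : pset k q) :
  linearly_equivalent X Y -> linearly_equivalent Y X.
Proof. by move=> [G [H [h1 h2]]]; exists H, G. Qed.

Lemma linearly_equivalent_trans r q t (X : pset k r) (Y : pset k q) (Z : pset k t) :
  linearly_equivalent X Y -> linearly_equivalent Y Z -> linearly_equivalent X Z.
Proof.
move=> [G [H [h1 h2]]] [G' [H' [h1' h2']]]; exists (G *m G'), (H' *m H); split.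
  move=> x /h1[/h1'[Zx e'] e]; split; first by rewrite mulmxA.
  by rewrite !mulmxA e' e.
move=> z /h2'[/h2[Xx e] e']; split; first by rewrite mulmxA.
by rewrite !mulmxA e e'.
Qed.

Lemma linearly_equivalent_eq r (X Y : pset k r) : eq_pset X Y -> linearly_equivalent X Y.
Proof. by move=> h; exists 1%:M, 1%:M; split=> x /h; rewrite !mulmx1. Qed.

(** Compose each embedding with a linear retraction of the other one. *)
Lemma projectively_equivalent_lin r q (X : pset k r) (Y : pset k q) :
  projectively_equivalent X Y -> linearly_equivalent X Y.
Proof.
move=> [m [J1 [J2 [/row_freeP[P1 f1] /row_freeP[P2 f2] h]]]].
exists (J1 *m P2), (J2 *m P1); split.
  move=> x Xx; have [y Yy e] : exists2 y, Y y & x *m J1 = y *m J2 by apply/h; exists x.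
  by rewrite mulmxA e -mulmxA f2 mulmx1 mulmxA -e -mulmxA f1 mulmx1.
move=> y Yy; have [x Xx e] : exists2 x, X x & y *m J2 = x *m J1 by apply/h; exists y.
by rewrite mulmxA e -mulmxA f1 mulmx1 mulmxA -e -mulmxA f2 mulmx1.
Qed.

Lemma row_free_retraction m n (A : 'M[k]_(m, n)) (B : 'M[k]_(n, m)) :
  A *m B = 1%:M -> row_free A.
Proof.
by move=> AB; apply: inj_row_free => v vA; rewrite -[v]mulmx1 -AB mulmxA vA mul0mx.
Qed.

(** The matrices [G] and [H] give the embeddings [x |-> (x G, x)] and [y |-> (y,
    y H)] into a common space; both are injective because one of their
    components is the identity. *)
Lemma lin_projectively_equivalent r q (X : pset k r) (Y : pset k q.+1) :
  linearly_equivalent X Y -> projectively_equivalent X Y.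
Proof.
move=> [G [H [h1 h2]]].
exists (q + r)%N, (row_mx G 1%:M : 'M_(r, q.+1 + r)), (row_mx 1%:M H : 'M_(q.+1, q.+1 + r)).
split.
- apply: (@row_free_retraction r (q.+1 + r) _ (col_mx 0 1%:M)).
  by rewrite mul_row_col mulmx0 add0r mulmx1.
- apply: (@row_free_retraction q.+1 (q.+1 + r) _ (col_mx 1%:M 0)).
  by rewrite mul_row_col mulmx0 addr0 mulmx1.
move=> z; split.
  move=> [x /h1[Yx e] ->]; exists (x *m G) => //.
  have E : x *m (row_mx G 1%:M) = x *m G *m row_mx 1%:M H.
    by rewrite !mul_mx_row !mulmx1 e.
  exact: E.
move=> [y /h2[Xy e] ->]; exists (y *m H) => //.
have E : y *m (row_mx 1%:M H) = y *m H *m row_mx G 1%:M.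
  by rewrite !mul_mx_row !mulmx1 e.
exact: E.
Qed.

(** The identity [x G H = x] is a system of linear equations, hence it extends
    from a set to its closure. *)
Lemma linearly_equivalent_zclosure r q (S : pset k r) (T : pset k q)
    (G : 'M[k]_(r, q)) (H : 'M[k]_(q, r)) :
  (forall x, S x -> T (x *m G) /\ x *m G *m H = x) ->
  (forall y, T y -> S (y *m H) /\ y *m H *m G = y) ->
  linearly_equivalent (zclosure S) (zclosure T).
Proof.
have main (r1 q1 : nat) (S1 : pset k r1) (T1 : pset k q1)
    (G1 : 'M[k]_(r1, q1)) (H1 : 'M[k]_(q1, r1)) :
  (forall x, S1 x -> T1 (x *m G1) /\ x *m G1 *m H1 = x) ->
  forall x, zclosure S1 x -> zclosure T1 (x *m G1) /\ x *m G1 *m H1 = x.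
  move=> h x hx; have e : x *m G1 *m H1 = x.
    apply/rowP => j; apply/eqP; rewrite -subr_eq0; apply/eqP.
    have hf : form 1 (fun x : 'rV[k]_r1 => (x *m (G1 *m H1)) 0 j - x 0 j).
      apply: form_ext (form_add (form_lin (G1 *m H1) j) (form_scale (-1) (form_coord j))).
      by move=> y; rewrite mulN1r.
    rewrite -mulmxA; apply: (zclosure_form hf _ hx) => y /h[_].
    by rewrite mulmxA => ->; rewrite subrr.
  split=> //; apply/zclosureP; split.
    by apply: contraNneq (zclosure_nz hx) => x0; rewrite -e x0 mul0mx.
  move=> d f hf fT; apply: (zclosure_form (form_pull G1 hf) _ hx) => y /h[].
  by move=> /fT.
by move=> h1 h2; exists G, H; split; apply: main.
Qed.

Definition has_chain r (X : pset k r) d := exists C, irreducible_chain X d C.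

Lemma linearly_equivalent_nz r q (X : pset k r) (G : 'M[k]_(r, q)) (H : 'M[k]_(q, r)) :
  closed X -> (forall x, X x -> x *m G *m H = x) -> forall x, X x -> x *m G != 0.
Proof.
move=> cX h x Xx; apply: contraNneq (closed_nz cX Xx) => x0.
by rewrite -(h x Xx) x0 mul0mx.
Qed.

(** The dimension of a set only involves its closed irreducible subsets, and
    these are transported by a linear equivalence. *)
Lemma closed_irreducible_transport r q (X : pset k r) (Y : pset k q)
    (G : 'M[k]_(r, q)) (H : 'M[k]_(q, r)) (C : pset k r) :
  closed X -> closed Y ->
  (forall x, X x -> Y (x *m G) /\ x *m G *m H = x) ->
  (forall y, Y y -> X (y *m H) /\ y *m H *m G = y) ->
  closed C -> irreducible C -> sub_pset C X ->
  closed (fun y => Y y /\ C (y *m H)) /\ irreducible (fun y => Y y /\ C (y *m H)).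
Proof.
move=> cX cY h1 h2 cC [[x Cx] iC] CX; split.
  by apply: closed_pull => //; apply: (linearly_equivalent_nz cY (H := G)) => y /h2[].
split; first by exists (x *m G); have [? ->] := h1 _ (CX _ Cx).
move=> D1 D2 c1 c2 hD.
have nz := linearly_equivalent_nz cX (fun x Xx => proj2 (h1 x Xx)).
case: (iC _ _ (closed_pull cX c1 nz) (closed_pull cX c2 nz)).
- move=> z Cz; have Xz := CX _ Cz; have [Yz ez] := h1 _ Xz.
  have [|dz|dz] := hD (z *m G); [by split; rewrite ?ez|left|right]; by split.
- by move=> h; left=> y [Yy Cy]; have [_] := h _ Cy; have [_ ->] := h2 _ Yy.
- by move=> h; right=> y [Yy Cy]; have [_] := h _ Cy; have [_ ->] := h2 _ Yy.
Qed.

Lemma linearly_equivalent_chain r q (X : pset k r) (Y : pset k q) d :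
  closed X -> closed Y -> linearly_equivalent X Y -> has_chain X d -> has_chain Y d.
Proof.
move=> cX cY [G [H [h1 h2]]] [C [hC hi]].
exists (fun i y => Y y /\ C i (y *m H)); split.
  move=> i id; have [cCi iCi sCi] := hC i id.
  by have [] := closed_irreducible_transport cX cY h1 h2 cCi iCi sCi; split=> // y [].
move=> i id; have [s1 s2] := hi i id; split.
  by move=> y [Yy Cy]; split=> //; apply: s1.
move=> s; apply: s2 => x Cx.
have [_ _ sX] := hC i.+1 id.
have [Yx e] := h1 _ (sX _ Cx).
by have [] := s (x *m G); rewrite ?e.
Qed.

Lemma linearly_equivalent_dim r q (X : pset k r) (Y : pset k q) d :
  closed X -> closed Y -> linearly_equivalent X Y -> has_dim X d -> has_dim Y d.
Proof.
move=> cX cY e [h1 h2]; split; first exact: linearly_equivalent_chain h1.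
by move=> h; apply: h2; apply: linearly_equivalent_chain h => //; apply: linearly_equivalent_sym.
Qed.

Lemma has_chain_trunc r (X : pset k r) d e : (e <= d)%N -> has_chain X d -> has_chain X e.
Proof.
move=> ed [C [h1 h2]]; exists C; split=> i ie; [apply: h1|apply: h2].
  exact: leq_trans ie ed.
exact: leq_trans ie ed.
Qed.

Lemma has_dim_uniq r (X : pset k r) d e : has_dim X d -> has_dim X e -> d = e.
Proof.
move=> [c1 n1] [c2 n2]; case: (ltngtP d e) => // lt.
  by case: n1; apply: has_chain_trunc lt c2.
by case: n2; apply: has_chain_trunc lt c1.
Qed.

Lemma linearly_equivalent_variety r q (X : pset k r) (Y : pset k q) :
  closed Y -> linearly_equivalent X Y -> projective_variety X -> irreducible Y.
Proof.
move=> cY [G [H [h1 h2]]] [cX iX].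
have [_ [[y [Yy _]] h]] := closed_irreducible_transport cX cY h1 h2 cX iX (fun x h => h).
split; first by exists y.
move=> C1 C2 c1 c2 hC; case: (h _ _ c1 c2) => [z [/hC] //|h'|h'].
  by left=> z Yz; apply: h'; split=> //; apply: (proj1 (h2 _ Yz)).
by right=> z Yz; apply: h'; split=> //; apply: (proj1 (h2 _ Yz)).
Qed.

End Forms.

(** * Restriction of polynomials to rational curves *)

Section Curves.
Variable k : closedFieldType.

(** The composition of [F] with the parametrized curve [g], as a polynomial in
    the parameter: identities known for all but finitely many parameters can
    then be differentiated. *)
Definition curve r (F : {mpoly k[r]}) (g : 'I_r -> {poly k}) : {poly k} :=
  mmap (@polyC k) g F.

Lemma horner_curve r (F : {mpoly k[r]}) (g : 'I_r -> {poly k}) s :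
  (curve F g).[s] = F.@[fun i => (g i).[s]].
Proof.
rewrite mevalE /curve /mmap horner_sum; apply: eq_bigr => m _.
rewrite hornerM hornerC /mmap1 horner_prod; congr (_ * _).
by apply: eq_bigr => i _; rewrite horner_exp.
Qed.

Lemma mpoly_ring_ind r (P : {mpoly k[r]} -> Prop) :
  (forall c, P c%:MP) -> (forall i, P 'X_i) ->
  (forall F G, P F -> P G -> P (F + G)) -> (forall F G, P F -> P G -> P (F * G)) ->
  forall F, P F.
Proof.
move=> hC hX hD hM; apply: mpolyind; first by rewrite -[0]/(0%:MP).
move=> c m F _ _ PF; apply: (hD) => //; rewrite -mul_mpolyC; apply: (hM) => //.
rewrite mpolyXE_id; apply: (big_ind P) => [|F' G|i _]; [exact: (hC 1)|exact: hM|].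
elim: (m i) => [|n IH]; first by rewrite expr0; apply: (hC 1).
by rewrite exprS; apply: hM.
Qed.

Lemma deriv_curve r (F : {mpoly k[r]}) (g : 'I_r -> {poly k}) s :
  (curve F g)^`().[s] = \sum_i F^`M(i).@[fun i => (g i).[s]] * (g i)^`().[s].
Proof.
rewrite /curve; move: F; apply: mpoly_ring_ind => [c|i|F G IF IG|F G IF IG].
- rewrite mmapC derivC horner0 big1 // => i _.
  by rewrite mderivC meval0 mul0r.
- have e0 : (U_(i) - U_(i))%MM = 0%MM :> 'X_{1..r}.
    by apply/mnmP => j; rewrite mnmBE subnn mnm0E.
  rewrite mmapX mmap1U (bigD1 i) //= big1 ?addr0 => [|j ji]; rewrite mderivX mnm1E.
    by rewrite eqxx scale1r e0 mpolyX0 meval1 mul1r.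
  by rewrite eq_sym (negbTE ji) scale0r meval0 mul0r.
- rewrite mmapD derivD hornerD IF IG -big_split /=; apply: eq_bigr => i _.
  by rewrite mderivD mevalD mulrDl.
rewrite rmorphM derivM hornerD !hornerM IF IG.
rewrite -!/(curve _ _) !horner_curve mulr_suml mulr_sumr -big_split /=.
apply: eq_bigr => i _; rewrite mderivM mevalD !mevalM mulrDl.
by congr (_ + _); rewrite ?mulrA // mulrAC.
Qed.

Lemma nonroot (P : {poly k}) : P != 0 -> exists s, P.[s] != 0.
Proof. by move=> /closed_nonrootP[s]; exists s. Qed.

End Curves.

(** * Monomial maps between tori *)

Section Torus.
Variable k : closedFieldType.

Definition torus m (t : 'rV[k]_m) := forall i, t 0 i != 0.

(** The homomorphism of tori with exponent matrix [E]: its i-th coordinate is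
    the Laurent monomial whose exponents are the i-th row of [E]. It is
    functorial in [E], see [tpowM]. *)
Definition tpow a b (E : 'M[int]_(a, b)) (t : 'rV[k]_b) : 'rV[k]_a :=
  \row_i \prod_j t 0 j ^ E i j.

Lemma tpow_torus a b (E : 'M[int]_(a, b)) t : torus t -> torus (tpow E t).
Proof. by move=> ht i; rewrite mxE; apply/prodf_neq0 => j _; rewrite expfz_neq0. Qed.

Lemma exprz_prod (I : Type) (s : seq I) (P : pred I) (f : I -> k) (z : int) :
  (forall i, f i != 0) -> \prod_(i <- s | P i) f i ^ z = (\prod_(i <- s | P i) f i) ^ z.
Proof.
move=> hf; elim: s => [|i s IH]; first by rewrite !big_nil exp1rz.
rewrite !big_cons; case: ifP => _ //; rewrite IH expfzMl //.
Qed.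

Lemma exprz_sum (I : Type) (s : seq I) (f : I -> int) (x : k) :
  x != 0 -> x ^ (\sum_(i <- s) f i) = \prod_(i <- s) x ^ f i.
Proof.
move=> x0; elim: s => [|i s IH]; first by rewrite !big_nil expr0z.
by rewrite !big_cons expfzDr // IH.
Qed.

Lemma tpowM a b c (E : 'M[int]_(a, b)) (F : 'M[int]_(b, c)) t :
  torus t -> tpow (E *m F) t = tpow E (tpow F t).
Proof.
move=> ht; apply/rowP => i; rewrite !mxE.
have -> : \prod_l tpow F t 0 l ^ E i l = \prod_l \prod_j t 0 j ^ (E i l * F l j).
  apply: eq_bigr => l _; rewrite mxE -exprz_prod => [|j]; last by rewrite expfz_neq0.
  by apply: eq_bigr => j _; rewrite mulrC exprz_exp.
rewrite exchange_big /=; apply: eq_bigr => j _.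
by rewrite mxE exprz_sum.
Qed.

Lemma tpow1 a (t : 'rV[k]_a) : tpow 1%:M t = t.
Proof.
apply/rowP => i; rewrite !mxE (bigD1 i) //= mxE eqxx expr1z big1 ?mulr1 // => j ji.
by rewrite mxE eq_sym (negbTE ji) expr0z.
Qed.

Lemma tpowD a b (E F : 'M[int]_(a, b)) t i :
  torus t -> tpow (E + F) t 0 i = tpow E t 0 i * tpow F t 0 i.
Proof.
by move=> ht; rewrite !mxE -big_split; apply: eq_bigr => j _; rewrite mxE expfzDr.
Qed.

Lemma tpow_zero_row a b (E : 'M[int]_(a, b)) t i : row i E = 0 -> tpow E t 0 i = 1.
Proof.
move=> /rowP E0; rewrite mxE big1 // => j _.
by move: (E0 j); rewrite !mxE => ->; rewrite expr0z.
Qed.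

Lemma tpow_col_mx a1 a2 b (E : 'M[int]_(a1, b)) (F : 'M[int]_(a2, b)) t :
  tpow (col_mx E F) t = row_mx (tpow E t) (tpow F t).
Proof.
apply/rowP => i; rewrite -[i]splitK; case: (split i) => j /=.
  by rewrite row_mxEl !mxE; apply: eq_bigr => l _; rewrite col_mxEu.
by rewrite row_mxEr !mxE; apply: eq_bigr => l _; rewrite col_mxEd.
Qed.

Lemma tpow_row_mx a b1 b2 (E : 'M[int]_(a, b1)) (F : 'M[int]_(a, b2)) s t i :
  tpow (row_mx E F) (row_mx s t) 0 i = tpow E s 0 i * tpow F t 0 i.
Proof.
rewrite !mxE big_split_ord /=; congr (_ * _); apply: eq_bigr => j _.
  by rewrite !row_mxEl.
by rewrite !row_mxEr.
Qed.

Lemma tpow_rowsub a a' b (f : 'I_a' -> 'I_a) (E : 'M[int]_(a, b)) t i :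
  tpow (rowsub f E) t 0 i = tpow E t 0 (f i).
Proof. by rewrite !mxE; apply: eq_bigr => j _; rewrite mxE. Qed.

Lemma tpow_rowE a b (E : 'M[int]_(a, b)) t i : tpow E t 0 i = tpow (row i E) t 0 0.
Proof. by rewrite !mxE; apply: eq_bigr => j _; rewrite mxE. Qed.

Lemma tpow_tmul a b (E : 'M[int]_(a, b)) (s t : 'rV[k]_b) i : torus s -> torus t ->
  tpow E (\row_j (s 0 j * t 0 j)) 0 i = tpow E s 0 i * tpow E t 0 i.
Proof.
move=> hs ht; rewrite !mxE -big_split; apply: eq_bigr => j _.
by rewrite mxE expfzMl.
Qed.

Lemma tpow_exp a b (E : 'M[int]_(a, b)) (t : 'rV[k]_b) n i :
  tpow E (\row_j (t 0 j ^+ n)) 0 i = tpow E t 0 i ^+ n.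
Proof.
rewrite !mxE -prodrXl; apply: eq_bigr => j _.
by rewrite mxE exprnP [RHS]exprnP !exprz_exp mulrC.
Qed.

Lemma tpow_natmul a b (E : 'M[int]_(a, b)) (t : 'rV[k]_b) n i :
  tpow (n%:Z *: E) t 0 i = tpow E t 0 i ^+ n.
Proof.
rewrite !mxE -prodrXl; apply: eq_bigr => j _.
by rewrite mxE [RHS]exprnP exprz_exp mulrC.
Qed.

Lemma root_exists (n : nat) (c : k) : (0 < n)%N -> exists x, x ^+ n = c.
Proof.
move=> n0; have : size ('X^n - c%:P) != 1%N by rewrite size_XnsubC // eqSS -lt0n.
by move=> /closed_rootP[x]; rewrite rootE !hornerE subr_eq0 => /eqP; exists x.
Qed.

Lemma rootz_exists (z : int) (c : k) : z != 0 -> c != 0 ->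
  exists2 x, x != 0 & x ^ z = c.
Proof.
move=> z0 c0; have [x hx] : exists x, x ^+ `|z|%N = c.
  by apply: root_exists; rewrite absz_gt0.
have x0 : x != 0.
  apply: contraNneq c0 => x0; rewrite -hx x0 expr0n.
  by rewrite (negbTE (_ : `|z|%N != 0%N)) // absz_eq0.
case: (intP z) z0 hx => // n _; rewrite ?abszN /= => hx; first by exists x.
by exists x^-1; rewrite ?invr_eq0 // exprz_inv opprK.
Qed.

Definition torus_orbit a b (E : 'M[int]_(a, b)) : pset k a :=
  fun x => exists2 t, torus t & x = tpow E t.

(** A shift by this bound turns all exponents of [E] into natural numbers; the
    common factor that it introduces is harmless for forms. *)
Definition exponent_bound a b (E : 'M[int]_(a, b)) : nat := \sum_i \sum_j `|E i j|%N.

Lemma exponent_bound_le a b (E : 'M[int]_(a, b)) i j : (`|E i j| <= exponent_bound E)%N.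
Proof. by rewrite /exponent_bound (bigD1 i) //= (bigD1 j) //= -addnA leq_addr. Qed.

Lemma shift_abs (e : int) (K : nat) : (`|e| <= K)%N -> (`|(e + K%:Z)%R|%N)%:Z = e + K%:Z.
Proof.
move=> h; rewrite gez0_abs //; lia.
Qed.

Lemma shift_expr (x : k) (e : int) (K : nat) : x != 0 -> (`|e| <= K)%N ->
  x ^+ `|(e + K%:Z)%R|%N = x ^+ K * x ^ e.
Proof. by move=> x0 h; rewrite exprnP shift_abs // expfzDr // mulrC. Qed.

Lemma torus_prod m (t : 'rV[k]_m) : torus t -> \prod_j t 0 j != 0.
Proof. by move=> ht; apply/prodf_neq0. Qed.

Lemma torus_orbit_nz a b (E : 'M[int]_(a, b)) (i : 'I_a) x : torus_orbit E x -> x != 0.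
Proof.
move=> [t ht ->]; apply: contraNneq (tpow_torus E ht i) => ->.
by rewrite mxE.
Qed.

(** If the orbit lies in the union of two closed sets but in none of them, take
    forms [f1], [f2] vanishing on these sets and points of parameters [t1], [t2]
    where they do not vanish. On the line joining [t1] and [t2] both forms are
    nonzero polynomials in one variable, and so is the product of the
    coordinates; hence some point of the line lies in the torus and is a zero of
    neither form. *)
Lemma irreducible_torus_orbit a b (E : 'M[int]_(a, b)) (i0 : 'I_a) : irreducible (torus_orbit E).
Proof.
split; first by exists (tpow E (const_mx 1)), (const_mx 1) => // i; rewrite mxE oner_eq0.
move=> C1 C2 c1 c2 hC; apply: NNPP => hn.
have [h1 h2] : (~ sub_pset (torus_orbit E) C1) /\ (~ sub_pset (torus_orbit E) C2).
  by split=> h; apply: hn; [left|right].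
have pick C : ~ sub_pset (torus_orbit E) C -> exists t, torus t /\ ~ C (tpow E t).
  move=> h; apply: NNPP => hh; apply: h => _ [t ht ->]; apply: NNPP => nC.
  by apply: hh; exists t.
have [t1 [ht1 n1]] := pick _ h1; have [t2 [ht2 n2]] := pick _ h2.
have nz t : torus t -> tpow E t != 0 by move=> ht; apply: (torus_orbit_nz i0 (E := E)); exists t.
have [d1 [f1 [hf1 z1 nf1]]] := notin_closed c1 n1 (nz _ ht1).
have [d2 [f2 [hf2 z2 nf2]]] := notin_closed c2 n2 (nz _ ht2).
pose K := exponent_bound E.
pose tau j : {poly k} := (t1 0 j)%:P + (t2 0 j - t1 0 j) *: 'X.
pose T s := \row_j (tau j).[s].
pose g i : {poly k} := \prod_j tau j ^+ `|(E i j + K%:Z)%R|%N.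
have T0 : T 0 = t1 by apply/rowP => j; rewrite mxE /tau hornerD hornerC hornerZ hornerX mulr0 addr0.
have T1 : T 1 = t2 by apply/rowP => j; rewrite mxE /tau hornerD hornerC hornerZ hornerX mulr1
  addrC subrK.
have gE s : torus (T s) -> \row_i (g i).[s] = (\prod_j T s 0 j ^+ K) *: tpow E (T s).
  move=> hT; apply/rowP => i; rewrite !mxE horner_prod -big_split; apply: eq_bigr => j _ /=.
  rewrite horner_exp mxE shift_expr ?exponent_bound_le //.
  by move: (hT j); rewrite mxE.
have [F1 hF1 f1F] := hf1; have [F2 hF2 f2F] := hf2.
have ev d (F : {mpoly k[a]}) (f : 'rV[k]_a -> k) s
    (hF : F \is d.-homog) (fF : forall x, f x = F.@[x 0]) :
    torus (T s) ->
    (curve F g).[s] = (\prod_j T s 0 j ^+ K) ^+ d * f (tpow E (T s)).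
  move=> hT; rewrite horner_curve.
  have hf : form d f by exists F.
  rewrite -(form_homogeneous _ _ hf) -gE // fF; apply: meval_eq => i.
  by rewrite mxE.
have cnz s : torus (T s) -> \prod_j T s 0 j ^+ K != 0.
  by move=> hT; apply/prodf_neq0 => j _; rewrite expf_neq0.
have pnz d (F : {mpoly k[a]}) (f : 'rV[k]_a -> k) s t :
    F \is d.-homog -> (forall x, f x = F.@[x 0]) -> T s = t -> torus t ->
    f (tpow E t) != 0 -> curve F g != 0.
  move=> hF fF Ts ht; apply: contraNneq => p0; move: (ht); rewrite -Ts => hT.
  have /esym/eqP := ev _ _ _ s hF fF hT.
  by rewrite p0 horner0 mulf_eq0 expf_eq0 (negbTE (cnz s hT)) andbF.
have p1 := pnz _ _ _ _ _ hF1 f1F T0 ht1 nf1.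
have p2 := pnz _ _ _ _ _ hF2 f2F T1 ht2 nf2.
have p3 : \prod_j tau j != 0.
  apply/prodf_neq0 => j _; apply: contraNneq (ht1 j) => t0.
  by rewrite -T0 mxE t0 horner0.
have [s] := nonroot (mulf_neq0 (mulf_neq0 p1 p2) p3).
rewrite !hornerM horner_prod !mulf_eq0 !negb_or => /andP[/andP[q1 q2] /prodf_neq0 q3].
have hT : torus (T s) by move=> j; rewrite mxE; apply: q3.
case: (hC (tpow E (T s))); first by exists (T s).
  by move=> /z1 e; move: q1; rewrite (ev _ _ _ s hF1 f1F) // e mulr0 eqxx.
by move=> /z2 e; move: q2; rewrite (ev _ _ _ s hF2 f2F) // e mulr0 eqxx.
Qed.

End Torus.

(** * The dimension of a toric variety *)

Section Dimension.
Variable k : closedFieldType.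

(** A lower bound [N] for the Hilbert function of [C] in degree [d]. *)
Definition forms_independent r (C : pset k r) d N :=
  exists f : 'I_N -> 'rV[k]_r -> k, (forall i, form d (f i)) /\
    forall c : 'I_N -> k, (forall x, C x -> \sum_i c i * f i x = 0) -> forall i, c i = 0.

Lemma forms_independent_sub r (C C' : pset k r) d N :
  sub_pset C C' -> forms_independent C d N -> forms_independent C' d N.
Proof.
move=> s [f [hf hi]]; exists f; split=> // c hc; apply: hi => x /s; exact: hc.
Qed.

Lemma forms_independent_leq r (C : pset k r) d N N' :
  (N' <= N)%N -> forms_independent C d N -> forms_independent C d N'.
Proof.
move=> le [f [hf hi]]; exists (fun i => f (widen_ord le i)); split=> // c hc i.
pose c' (j : 'I_N) := if insub (val j) is Some j' then c j' else 0.
have cE j : c' (widen_ord le j) = c j.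
  rewrite /c' /=; case: insubP => [u _ /val_inj -> //|]; by rewrite ltn_ord.
rewrite -cE; apply: hi => x Cx; rewrite -[RHS](hc x Cx).
rewrite (bigID (fun j : 'I_N => (j < N')%N)) /= [X in _ + X]big1 ?addr0; last first.
  by move=> j nj; rewrite /c'; case: insubP nj => [u -> //|]; rewrite mul0r.
rewrite (big_ord_narrow le); apply: eq_bigr => j _.
by rewrite cE.
Qed.

Lemma irreducible_form_mul r (C : pset k r) d e f g :
  closed C -> irreducible C -> form d f -> form e g ->
  (forall x, C x -> f x * g x = 0) ->
  (forall x, C x -> f x = 0) \/ (forall x, C x -> g x = 0).
Proof.
move=> cC [_ iC] hf hg fg; case: (iC _ _ (closed_form hf) (closed_form hg)).
- move=> x Cx; have x0 := closed_nz cC Cx.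
  by have /eqP := fg x Cx; rewrite mulf_eq0 => /orP[] /eqP; [left|right].
- by move=> h; left=> x /h[].
- by move=> h; right=> x /h[].
Qed.

(** If [F] vanishes on [C'] but not on the irreducible [C], then the multiples
    of [F] by independent forms on [C], together with independent forms on [C'],
    stay independent on [C]: restrict a relation to [C'] first, then divide it
    by [F]. *)
Lemma forms_independent_step r (C C' : pset k r) d e (F : 'rV[k]_r -> k) N N' :
  closed C -> irreducible C -> sub_pset C' C -> form e F ->
  (forall x, C' x -> F x = 0) -> ~ (forall x, C x -> F x = 0) ->
  forms_independent C d N -> forms_independent C' (e + d) N' ->
  forms_independent C (e + d) (N + N').
Proof.
move=> cC iC sC hF FC' FC [f [hf fi]] [g [hg gi]].
pose h (i : 'I_(N + N')) x := match split i with inl i => F x * f i x | inr j => g j x end.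
exists h; split.
  move=> i; rewrite /h; case: (split i) => j; last exact: hg.
  exact: form_mul.
move=> c hc.
have splitl i : split (lshift N' i) = inl i :> 'I_N + 'I_N' by exact: (unsplitK (inl i)).
have splitr j : split (rshift N j) = inr j :> 'I_N + 'I_N' by exact: (unsplitK (inr j)).
have E x : \sum_i c i * h i x = F x * (\sum_i c (lshift N' i) * f i x)
    + \sum_j c (rshift N j) * g j x.
  rewrite big_split_ord /=; congr (_ + _).
    rewrite big_distrr /=; apply: eq_bigr => i _.
    by rewrite /h splitl mulrCA.
  by apply: eq_bigr => i _; rewrite /h splitr.
have c2 j : c (rshift N j) = 0.
  apply: (gi (fun j => c (rshift N j))) => x C'x.
  by have := hc x (sC _ C'x); rewrite E FC' // mul0r add0r.
have c1 i : c (lshift N' i) = 0.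
  apply: (fi (fun i => c (lshift N' i))) => x Cx.
  have hs : form d (fun x => \sum_i c (lshift N' i) * f i x).
    by apply: form_sum => j _; apply: form_scale.
  case: (irreducible_form_mul cC iC hF hs) => [y Cy|//|h']; last exact: h'.
  have := hc y Cy; rewrite E [X in _ + X]big1 ?addr0 // => j _.
  by rewrite c2 mul0r.
by move=> i; rewrite -[i]splitK; case: (split i) => j /=.
Qed.

Lemma separating_form r (C C' : pset k r) :
  closed C -> closed C' -> (exists x, C' x) -> ~ sub_pset C C' ->
  exists e F, [/\ (0 < e)%N, form e F, forall x, C' x -> F x = 0 & ~ (forall x, C x -> F x = 0)].
Proof.
move=> cC cC' [y C'y] ns.
have [x [Cx nx]] : exists x, C x /\ ~ C' x.
  by apply: NNPP => h; apply: ns => x Cx; apply: NNPP => nx; apply: h; exists x.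
have [[|e] [F [hF F0 Fx]]] := notin_closed cC' nx (closed_nz cC Cx).
  (* A form of degree 0 is constant, and it vanishes at the point [y] of [C']. *)
  have hx := form_homogeneous 0 x hF; have hy := form_homogeneous 0 y hF.
  rewrite !scale0r !expr0 !mul1r in hx hy.
  by case/negP: Fx; rewrite -hx hy F0.
by exists e.+1, F; split=> // h; move: Fx; rewrite h ?eqxx.
Qed.

(** Along a chain of irreducible closed sets the Hilbert function gains one
    degree of growth at every step, by [forms_independent_step] and the rule of
    Pascal. *)
Lemma chain_growth r (X : pset k r) d C : irreducible_chain X d C ->
  forall i, (i <= d)%N ->
    exists2 e, (0 < e)%N & forall n, forms_independent (C i) (e * n) 'C(n + i, i).
Proof.
move=> [h1 h2]; elim=> [|i IH] id.
  have [cC [[x Cx] _] _] := h1 0 id; exists 1%N => // n; rewrite bin0 mul1n.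
  have [j xj] : exists j, x 0 j != 0.
    apply: NNPP => h; case/negP: (closed_nz cC Cx); apply/eqP/rowP => j.
    by rewrite mxE; apply/eqP/negPn/negP => xj; apply: h; exists j.
  exists (fun _ x => x 0 j ^+ n); split=> [_|c hc i].
    by have := form_exp n (@form_coord k _ j); rewrite mul1n.
  have /eqP := hc x Cx; rewrite big_ord1 mulf_eq0 expf_eq0 (negbTE xj) andbF orbF.
  by rewrite (ord1 i) => /eqP.
have [e e0 He] := IH (ltnW id).
have [cC iC sC] := h1 _ id; have [cC' iC' sC'] := h1 _ (ltnW id); have [s ns] := h2 _ id.
have [e' [F [e'0 hF F0 Fn]]] := separating_form cC cC' (proj1 iC') ns.
(* Multiplying the two degrees lets a power of [F] have the degree of the forms
   given by induction. *)
exists (e' * e)%N; first by rewrite muln_gt0 e'0.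
have Fn' : ~ (forall x, C i.+1 x -> F x ^+ e = 0).
  move=> h; apply: Fn => x /h/eqP; rewrite expf_eq0 e0 /=; by move/eqP.
have F0' x : C i x -> F x ^+ e = 0 by move=> /F0 ->; rewrite expr0n eqn0Ngt e0.
elim=> [|n IHn].
  rewrite add0n binn muln0; exists (fun _ _ => 1); split=> [_|c hc j].
    exact: form_const.
  have [[x Cx] _] := iC; have := hc x Cx; rewrite big_ord1 mulr1 => <-.
  by rewrite (ord1 j).
rewrite addSn binS mulnS.
apply: (forms_independent_step cC iC s (form_exp e hF) F0' Fn' IHn).
rewrite -mulnS -mulnA mulnCA.
apply: forms_independent_leq (He _); rewrite -addSnnS.
apply: leq_bin2l.
by rewrite leq_add2r leq_pmull.
Qed.

(** Forms of degree [d] restrict to combinations of Laurent monomials whose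
    exponents lie in a box of side [2 d K + 1], where [K] bounds the entries of
    [E]; there are no more independent ones than points in the box. *)
Lemma forms_independent_torus_orbit a b (E : 'M[int]_(a, b)) d N :
  forms_independent (zclosure (torus_orbit (k := k) E)) d N ->
  (N <= ((2 * (d * exponent_bound E)).+1) ^ b)%N.
Proof.
move=> [f [hf fi]]; set K := (d * exponent_bound E)%N.
pose I := {ffun 'I_b -> 'I_(2 * K).+1}.
pose ex (m : 'X_{1..a}) j : int := \sum_i (m i)%:Z * E i j.
(* The exponents of the monomial [m] composed with the parametrization, moved
   into the box. *)
pose idx (m : 'X_{1..a}) : I := [ffun j => inord `|(ex m j + K%:Z)%R|%N].
have exle (m : 'X_{1..a}) j : mdeg m = d -> (`|ex m j| <= K)%N.
  move=> md; apply: (@leq_trans (\sum_i `|((m i)%:Z * E i j)%R|%N)).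
    rewrite /ex; elim/big_rec2: _ => // i y1 y2 _ h.
    by set z := (_ * _)%R; lia.
  apply: (@leq_trans (\sum_i (m i * exponent_bound E))).
    apply: leq_sum => i _; rewrite abszM leq_mul2l.
    by rewrite exponent_bound_le orbT.
  by rewrite -big_distrl /= -mdegE md.
have main i : exists co : I -> k, forall t : 'rV[k]_b, torus t ->
    (\prod_j t 0 j) ^+ K * f i (tpow E t) = \sum_(e : I) co e * \prod_j t 0 j ^+ e j.
  have [F hF fF] := hf i.
  exists (fun e => \sum_(m <- msupp F | idx m == e) F@_m) => t ht.
  rewrite fF mevalE big_distrr /=.
  under [RHS]eq_bigr => e _ do rewrite big_distrl /=.
  rewrite (exchange_big_dep predT) //= big_seq [RHS]big_seq; apply: eq_bigr => m mF.
  rewrite (big_pred1 (idx m)) => [|e]; last by rewrite eq_sym.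
  rewrite mulrCA; congr (_ * _).
  have md : mdeg m = d := dhomogP _ _ _ hF _ mF.
  have -> : \prod_i0 tpow E t 0 i0 ^+ m i0 = \prod_j t 0 j ^ ex m j.
    under eq_bigr => l _ do rewrite mxE -prodrXl.
    rewrite exchange_big /=; apply: eq_bigr => j _.
    rewrite /ex exprz_sum //; apply: eq_bigr => l _.
    by rewrite exprnP exprz_exp mulrC.
  rewrite -prodrXl -big_split; apply: eq_bigr => j _ /=.
  rewrite ffunE inordK; last by have := exle m j md; lia.
  by rewrite shift_expr // exle.
have [co hco] : exists co : 'I_N -> I -> k, forall i t, torus t ->
    (\prod_j t 0 j) ^+ K * f i (tpow E t) = \sum_(e : I) co i e * \prod_j t 0 j ^+ e j.
  exact: (fin_all_exists main).
pose M := \matrix_(i < N, j < #|I|) co i (enum_val j).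
have /eqP <- : row_free M.
  apply: inj_row_free => v vM.
  suff h : forall x, torus_orbit E x -> \sum_i v 0 i * f i x = 0.
    apply/rowP => i; rewrite mxE; apply: (fi (fun i => v 0 i)) => x.
    apply: (zclosure_form (d := d) (f := fun x => \sum_i v 0 i * f i x)) => //.
    by apply: form_sum => j _; apply: form_scale.
  move=> _ [t ht ->]; have t0 : (\prod_j t 0 j) ^+ K != 0 by rewrite expf_neq0 ?torus_prod.
  apply: (mulfI t0); rewrite mulr0 big_distrr /=.
  under eq_bigr => i _ do rewrite mulrCA hco // big_distrr /=.
  rewrite exchange_big /= big1 // => e _.
  under eq_bigr => i _ do rewrite mulrA.
  rewrite -big_distrl /=; have /rowP/(_ (enum_rank e)) := vM.
  rewrite [LHS]mxE [RHS]mxE => h.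
  have -> : \sum_i v 0 i * co i e = 0; last by rewrite mul0r.
  by rewrite -[RHS]h; apply: eq_bigr => i _; rewrite [M _ _]mxE enum_rankK.
apply: leq_trans (rank_leq_col _) _.
by rewrite card_ffun !card_ord.
Qed.

Lemma poly_growth b (c e : nat) :
  ~ (forall n, ('C(n + b.+1, b.+1) <= (2 * (e * n * c)).+1 ^ b)%N).
Proof.
(* At [M] the lower bound [(M + 1) ^ (b + 1) / (b + 1)!] for the binomial
   exceeds the upper bound. *)
pose M := (b.+1`! * (2 * (e * c)).+1 ^ b)%N.
move=> /(_ M) h.
have h1 : (M.+1 ^ b.+1 <= 'C(M + b.+1, b.+1) * b.+1`!)%N.
  rewrite bin_ffact.
  elim: (b.+1) => [|n IH]; first by rewrite ffactn0.
  rewrite addnS ffactSS expnS leq_mul //; first by rewrite ltnS leq_addr.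
have h2 : ((2 * (e * M * c)).+1 <= (2 * (e * c)).+1 * M.+1)%N.
  by rewrite mulnAC; move: (e * c)%N (M) => q m; clear; nia.
have h3 : (M.+1 ^ b.+1 <= M * M.+1 ^ b)%N.
  have -> : (M * M.+1 ^ b = b.+1`! * ((2 * (e * c)).+1 ^ b * M.+1 ^ b))%N by rewrite mulnA.
  apply: leq_trans h1 _; rewrite mulnC leq_mul2l; apply/orP; right.
  rewrite -expnMn; apply: leq_trans h _.
  by case: (posnP b) => [->|b0] //; rewrite leq_exp2r.
by move: h3; rewrite expnS leq_mul2r expn_eq0 ltnn.
Qed.

Lemma dim_upper a b (E : 'M[int]_(a, b)) : ~ has_chain (zclosure (torus_orbit (k := k) E)) b.+1.
Proof.
move=> [C hC]; have [e _ he] := chain_growth hC (leqnn _).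
apply: (@poly_growth b (exponent_bound E) e) => n.
apply: forms_independent_torus_orbit; apply: forms_independent_sub (he n).
by have [_ _] := (proj1 hC) _ (leqnn _).
Qed.

Lemma torus_orbit_mul_sub a b c (E : 'M[int]_(a, b)) (F : 'M[int]_(b, c)) :
  sub_pset (torus_orbit (k := k) (E *m F)) (torus_orbit E).
Proof. by move=> _ [t ht ->]; exists (tpow F t); [exact: tpow_torus|rewrite tpowM]. Qed.

Lemma non01 : exists2 z : k, z != 0 & z != 1.
Proof.
have : ('X * ('X - 1%:P) : {poly k}) != 0 by rewrite mulf_neq0 ?polyX_eq0 ?polyXsubC_eq0.
move=> /nonroot[z]; rewrite hornerM hornerX hornerXsubC mulf_eq0 negb_or subr_eq0.
by case/andP; exists z.
Qed.

(** The coordinates [g 0], ..., [g b.-1], divided by the coordinate [i0], are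
    independent characters. The columns of the adjugate matrix are one-parameter
    subgroups dual to them up to the factor [D], and the closures of the orbits
    of the subtori that the first [i] of them generate form a chain; the linear
    form [x_(g i) - x_i0] separates two consecutive ones. *)
Lemma torus_orbit_chain a b (E : 'M[int]_(a, b)) (i0 : 'I_a) (g : 'I_b -> 'I_a) :
  row i0 E = 0 -> \det (rowsub g E) != 0 -> has_chain (zclosure (torus_orbit (k := k) E)) b.
Proof.
move=> E0 D0; set D := \det _ in D0.
pose L := \adj (rowsub g E).
pose F i : 'M[int]_(a, b) := E *m L *m pid_mx i.
have FE i j l : F i (g j) l = D * (pid_mx i : 'M_b) j l.
  have : rowsub g (F i) = D%:M *m pid_mx i by rewrite /F -!mul_rowsub_mx mul_mx_adj.
  by rewrite mul_scalar_mx => /matrixP/(_ j l); rewrite mxE => ->; rewrite mxE.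
have F0 i : row i0 (F i) = 0 by rewrite /F !row_mul E0 !mul0mx.
exists (fun i => zclosure (torus_orbit (F i))); split.
  move=> i ib; split.
  - exact: zclosure_closed.
  - apply: irreducible_zclosure; last exact: irreducible_torus_orbit i0.
    by move=> x; apply: (torus_orbit_nz i0).
  - by apply: zclosure_sub; rewrite /F -mulmxA; apply: torus_orbit_mul_sub.
move=> i ib; split.
  apply: zclosure_sub; have -> : F i = F i.+1 *m pid_mx i.
    rewrite /F -[RHS]mulmxA mul_pid_mx; congr (_ *m pid_mx _); lia.
  exact: torus_orbit_mul_sub.
move=> s; pose j := Ordinal ib.
have hf : form 1 (fun x : 'rV[k]_a => x 0 (g j) + (-1) * x 0 i0).
  by apply: form_add; [|apply: form_scale]; apply: form_coord.
have [z z0 z1] := non01; have [y y0 yz] := rootz_exists D0 z0.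
pose t : 'rV[k]_b := \row_l if l == j then y else 1.
have ht : torus t by move=> l; rewrite mxE; case: ifP => _ //; apply: oner_neq0.
have := zclosure_form hf _ (s (tpow (F i.+1) t) _).
rewrite (tpow_zero_row _ (F0 _)) mulr1 => h; case/eqP: z1; apply/eqP.
rewrite -subr_eq0 -h.
- rewrite mxE (bigD1 j) //= big1 ?mulr1 => [|l lj].
    by rewrite mxE eqxx FE mxE eqxx ltnSn /= mulr1 yz.
  by rewrite mxE (negbTE lj) exp1rz.
- move=> _ [u hu ->]; rewrite (tpow_zero_row _ (F0 _)) mulr1 tpow_zero_row ?subrr //.
  apply/rowP => l; rewrite mxE FE mxE [X in _ && X]ltnNge /=.
  by rewrite leqnn andbF mulr0 mxE.
by apply: sub_zclosure; [apply: (torus_orbit_nz i0 (E := F i.+1))|]; exists t.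
Qed.

Lemma dim_torus_orbit a b (E : 'M[int]_(a, b)) (i0 : 'I_a) (g : 'I_b -> 'I_a) :
  row i0 E = 0 -> \det (rowsub g E) != 0 -> has_dim (zclosure (torus_orbit (k := k) E)) b.
Proof. by move=> h1 h2; split; [exact: torus_orbit_chain h1 h2|exact: dim_upper]. Qed.

End Dimension.

(** * Normal form of a projectively embedded toric variety *)

Section ToricNormalForm.
Variable k : closedFieldType.

Definition distinct_rows a b (E : 'M[int]_(a, b)) := forall i j, row i E = row j E -> i = j.

Lemma character_separates b (u v : 'rV[int]_b) : u != v ->
  exists2 t : 'rV[k]_b, torus t & tpow u t 0 0 != tpow v t 0 0.
Proof.
move=> uv; have [j uvj] : exists j, u 0 j != v 0 j.
  apply: NNPP => h; case/eqP: uv; apply/rowP => j; apply/eqP/negPn/negP => nj.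
  by apply: h; exists j.
have [z z0 z1] := non01 k.
have d0 : u 0 j - v 0 j != 0 by rewrite subr_eq0.
have [y y0 yz] := rootz_exists d0 z0.
exists (\row_l if l == j then y else 1).
  by move=> l; rewrite mxE; case: ifP => _ //; apply: oner_neq0.
have E (w : 'rV[int]_b) : tpow w (\row_l (if l == j then y else 1)) 0 0 = y ^ w 0 j.
  rewrite mxE (bigD1 j) //= big1 ?mulr1 => [|l lj]; first by rewrite mxE eqxx.
  by rewrite mxE (negbTE lj) exp1rz.
rewrite !E; apply: contraNneq z1 => e; rewrite -yz expfzDr // e -expfzDr //.
by rewrite subrr expr0z.
Qed.

(** The usual argument: a relation evaluated at [s t] minus [chi_i (s)] times
    the relation evaluated at [t] is shorter. *)
Lemma dedekind a b (E : 'M[int]_(a, b)) (c : 'I_a -> k) : distinct_rows E ->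
  (forall t, torus t -> \sum_i c i * tpow E t 0 i = 0) -> forall i, c i = 0.
Proof.
move=> inj; move: {2}#|_| (leqnn #|[set i | c i != 0]|) => n.
elim: n c => [|n IH] c le hc i.
  move: le; rewrite leqn0 cards_eq0 => /eqP/setP/(_ i); rewrite !inE.
  by move/negbT/negPn/eqP.
apply/eqP/negPn/negP => ci.
have cj j : j != i -> c j = 0.
  move=> ji; have [s hs sij] : exists2 s : 'rV[k]_b, torus s & tpow E s 0 j != tpow E s 0 i.
    have [|s hs h] := @character_separates _ (row j E) (row i E).
      by apply: contraNneq ji => /inj ->.
    by exists s => //; rewrite tpow_rowE [X in _ != X]tpow_rowE.
  have : c j * (tpow E s 0 j - tpow E s 0 i) = 0.
    apply: (IH (fun j => c j * (tpow E s 0 j - tpow E s 0 i))).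
      rewrite -ltnS; apply: leq_trans le; apply: proper_card.
      apply/properP; split.
        by apply/subsetP => l; rewrite !inE mulf_eq0 negb_or => /andP[].
      by exists i; rewrite !inE // subrr mulr0 eqxx.
    move=> t ht; have h1 := hc _ ht.
    have hst : torus (\row_j (s 0 j * t 0 j)) by move=> l; rewrite mxE mulf_neq0.
    have h2 := hc _ hst.
    have e : \sum_l c l * tpow E (\row_j (s 0 j * t 0 j)) 0 l
        - tpow E s 0 i * (\sum_l c l * tpow E t 0 l) = 0 by rewrite h1 h2 mulr0 subrr.
    rewrite -[RHS]e big_distrr /= -sumrB; apply: eq_bigr => l _.
    by rewrite tpow_tmul // mulrBr mulrBl !mulrA [tpow E s 0 i * _]mulrC.
  by move/eqP; rewrite mulf_eq0 subr_eq0 (negbTE sij) orbF => /eqP.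
have h1 : torus (const_mx 1 : 'rV[k]_b) by move=> l; rewrite mxE oner_neq0.
have := hc _ h1; rewrite (bigD1 i) //= big1 ?addr0 => [|j /cj ->]; last by rewrite mul0r.
by move/eqP; rewrite mulf_eq0 (negbTE ci) (negbTE (tpow_torus _ h1 _)).
Qed.

(** By [dedekind], an orbit with distinct exponents spans the ambient space. *)
Lemma torus_orbit_span a b q (E : 'M[int]_(a, b)) (A A' : 'M[k]_(a, q)) : distinct_rows E ->
  (forall x, torus_orbit E x -> x *m A = x *m A') -> A = A'.
Proof.
move=> inj h; apply/matrixP => i j; apply/eqP; rewrite -subr_eq0; apply/eqP.
apply: (dedekind (c := fun i => A i j - A' i j) inj) => t ht.
have /rowP/(_ j) := h _ (ex_intro2 _ _ t ht erefl); rewrite !mxE => e.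
under eq_bigr => l _ do rewrite mulrBl.
rewrite sumrB; apply/eqP; rewrite subr_eq0; apply/eqP.
under eq_bigr => l _ do rewrite mulrC.
by rewrite e; apply: eq_bigr => l _; rewrite mulrC.
Qed.

(** Over the lattice of row vectors, a point of the torus amounts to its values
    on the standard basis. *)
Lemma torus_character m (T : 'rV[int]_m -> k) : torus_point T ->
  exists2 s : 'rV[k]_m, torus s & forall u, T u = tpow u s 0 0.
Proof.
move=> [T0 TD].
have TN u : T u * T (- u) = 1 by rewrite -TD subrr.
have Tnz u : T u != 0.
  by apply/eqP => h; have /eqP := TN u; rewrite h mul0r eq_sym oner_eq0.
have Tn u (n : nat) : T (u *+ n) = T u ^+ n.
  by elim: n => [|n IH]; rewrite ?mulr0n ?T0 // mulrS TD IH exprS.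
have Tz u (z : int) : T (z *: u) = T u ^ z.
  rewrite -[z *: u]/(z *: u) -{1}[z]intz scaler_int.
  case: (intP z) => [|n|n]; first by rewrite mulr0z T0 expr0z.
    by rewrite -pmulrn Tn.
  rewrite mulrNz -pmulrn -exprz_inv; apply: (mulfI (Tnz (u *+ n.+1))).
  by rewrite TN Tn -exprnP -exprMn mulfV // expr1n.
exists (\row_j T (delta_mx 0 j)) => [j|u]; first by rewrite mxE.
rewrite {1}[u]row_sum_delta (big_morph T TD T0) mxE.
by apply: eq_bigr => j _; rewrite Tz mxE.
Qed.

Lemma toric_orbit (M : zmodType) m (f : {additive M -> 'rV[int]_m}) N (A : 'I_N.+1 -> M) :
  bijective f ->
  eq_pset (toric (k := k) A) (zclosure (torus_orbit (\matrix_(i, j) f (A i) 0 j))).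
Proof.
move=> [g fK gK].
have rE i : row i (\matrix_(i, j) f (A i) 0 j) = f (A i).
  by apply/rowP => j; rewrite !mxE.
have gD u v : g (u + v) = g u + g v by apply: (can_inj fK); rewrite raddfD !gK.
have g0 : g 0 = 0 by apply: (can_inj fK); rewrite raddf0 gK.
have h (x : 'rV[k]_N.+1) : (exists2 t : M -> k, torus_point t & x = \row_i t (A i)) <->
    torus_orbit (\matrix_(i, j) f (A i) 0 j) x.
  split=> [[t [t0 tD] ->]|[s hs ->]].
    have [|s hs e] := @torus_character _ (t \o g).
      by split=> [|u v] /=; rewrite ?g0 ?gD.
    by exists s => //; apply/rowP => i; rewrite mxE tpow_rowE rE -e /= fK.
  exists (fun u => tpow (f u) s 0 0).
    split; first by rewrite raddf0 tpow_zero_row // row0.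
    by move=> u v; rewrite raddfD tpowD.
  by apply/rowP => i; rewrite mxE tpow_rowE rE.
by move=> x; split; apply: zclosure_sub => y /h.
Qed.

(** In the Smith form [L D R], keep the columns of [L] that meet nonzero entries
    of [D]. They have an integral left inverse, and the remaining factor is a
    surjective homomorphism of tori because nonzero elements have roots of all
    orders. So the orbit of [E0] is also that of [E], whose exponents generate
    the whole lattice. *)
Lemma smith_factorization N m (E0 : 'M[int]_(N, m)) :
  exists r (E : 'M[int]_(N, r)) (B : 'M[int]_(r, N)) (Q : 'M[int]_(r, m)),
  [/\ B *m E = 1%:M, E0 = E *m Q &
      forall s : 'rV[k]_r, torus s -> exists2 t, torus t & tpow Q t = s].
Proof.
have [L uL [R uR [d _ ->]]] := int_Smith_normal_form E0.
set D := (X in L *m X *m R); pose S := [set b : 'I_N | (b < m)%N && (d`_b != 0)].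
pose f (i : 'I_#|S|) := enum_val i.
have fS i : (f i < m)%N /\ d`_(f i) != 0.
  by have := enum_valP i; rewrite inE => /andP.
exists #|S|, (colsub f L), (rowsub f (invmx L)), (rowsub f D *m R); split.
- transitivity (mxsub f f (invmx L *m L)).
    by apply/matrixP => i j; rewrite !mxE; apply: eq_bigr => l _; rewrite !mxE.
  rewrite mulVmx //; apply/matrixP => i j; rewrite !mxE.
  by rewrite (inj_eq enum_val_inj).
- rewrite mulmxA; congr (_ *m _); apply/matrixP => i j; rewrite !mxE.
  rewrite (bigID (mem S)) /= [X in _ + X]big1 ?addr0 => [|b]; last first.
    rewrite inE negb_and -leqNgt negbK => h; rewrite [D _ _]mxE.
    have [e|_] := (b =P j :> nat); last by rewrite mulr0n mulr0.
    by move: h; rewrite e leqNgt ltn_ord /= -e => /eqP ->; rewrite mulr1n mulr0.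
  by rewrite big_enum_val; apply: eq_bigr => l _; rewrite !mxE.
move=> s hs.
(* Extract the required root in every coordinate that [D] meets, and take 1
   elsewhere. *)
have /fin_all_exists[t' ht'] : forall j : 'I_m, exists x : k,
    x != 0 /\ forall i, f i = j :> nat -> x ^ d`_(f i) = s 0 i.
  move=> j; case: (pickP (fun i => f i == j :> nat)) => [i /eqP fi|h].
    have [x x0 hx] := rootz_exists (proj2 (fS i)) (hs i).
    exists x; split=> // i' fi'; suff -> : i' = i by [].
    by apply: enum_val_inj; apply: val_inj; rewrite /= -/(f i) -/(f i') fi fi'.
  by exists 1; split=> [|i /eqP]; rewrite ?oner_neq0 ?h.
have tt' : torus (\row_j t' j) by move=> j; rewrite mxE; case: (ht' j).
exists (tpow (invmx R) (\row_j t' j)); first exact: tpow_torus.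
rewrite tpowM; last exact: tpow_torus.
rewrite -[tpow R _]tpowM // mulmxV // tpow1.
apply/rowP => i; rewrite mxE (bigD1 (Ordinal (proj1 (fS i)))) //= big1 ?mulr1.
  by rewrite !mxE /= eqxx mulr1n; case: (ht' (Ordinal (proj1 (fS i)))) => _ ->.
move=> j ji; rewrite !mxE; case: eqP => [e|_]; last by rewrite mulr0n expr0z.
by case/eqP: ji; apply: val_inj.
Qed.

(** An integral left inverse stays a left inverse modulo the characteristic, so
    some maximal minor survives there. *)
Lemma full_rank_minor a r (E : 'M[int]_(a, r)) (B : 'M[int]_(r, a)) :
  B *m E = 1%:M -> exists2 g : 'I_r -> 'I_a, injective g & (\det (rowsub g E))%:~R != 0 :> k.
Proof.
move=> BE; pose Ek := map_mx (intr : int -> k) E.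
have full : row_full Ek.
  apply/row_fullP; exists (map_mx intr B).
  by rewrite -map_mxM BE map_mx1.
exists (fullrankfun full); first exact: fullrankfun_inj.
have := fullrowsub_unit full; rewrite unitmxE unitfE.
by rewrite -map_mxsub det_map_mx.
Qed.

(** The exponents are translated so that the first one is zero, then replaced by
    generators of the lattice with [smith_factorization]. As the rows of [B]
    have sum zero, [B] expresses the torus parameters as monomials of degree
    zero in the homogeneous coordinates. The identity [G *m H = 1], and with it
    a bound for the number of exponents, comes from [torus_orbit_span]. *)
Lemma toric_normal_form R (Y : pset k R.+1) : projectively_embedded_toric Y ->
  exists N r (E : 'M[int]_(N.+1, r)) (B : 'M[int]_(r, N.+1))
    (G : 'M[k]_(N.+1, R.+1)) (H : 'M[k]_(R.+1, N.+1)),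
  [/\ [/\ row 0 E = 0, distinct_rows E, B *m E = 1%:M & B *m const_mx 1 = 0 :> 'cV_r],
      G *m H = 1%:M,
      forall x, zclosure (torus_orbit E) x -> Y (x *m G) &
      forall y, Y y -> zclosure (torus_orbit E) (y *m H) /\ y *m H *m G = y].
Proof.
move=> [[cY _] [M [N [A [fM Ainj /projectively_equivalent_lin YA]]]]].
have [m [f fbij]] := fM; have tE := toric_orbit A fbij.
set E0' := \matrix_(i, j) _ in tE.
have rE i : row i E0' = f (A i) by apply/rowP => j; rewrite !mxE.
have inj0' : distinct_rows E0' by move=> i j; rewrite !rE => /(bij_inj fbij)/Ainj.
clearbody E0'.
pose E0 : 'M[int]_(1 + N, m) := \matrix_(i, j) (E0' i j - E0' 0 j).
have [r [E1 [B1 [Q [BE EQ surj]]]]] := smith_factorization (dsubmx E0).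
have E00 : row 0 E0 = 0 by apply/rowP => j; rewrite !mxE subrr.
pose E : 'M[int]_(1 + N, r) := col_mx 0 E1.
have EE : E0 = E *m Q.
  rewrite mul_col_mx mul0mx -EQ -[LHS]vsubmxK; congr col_mx.
  apply/rowP => j; rewrite !mxE.
  by apply/eqP; rewrite subr_eq0; apply/eqP; congr (E0' _ _); apply: val_inj.
have Einj : distinct_rows E.
  move=> i j eij; apply: inj0'.
  have : row i E0 = row j E0 by rewrite EE !row_mul eij.
  by move=> /rowP h; apply/rowP => l; have := h l; rewrite !mxE => /addIr.
have oE : eq_pset (zclosure (torus_orbit (k := k) E0')) (zclosure (torus_orbit E)).
  have c0 t (ht : torus t) : tpow E0' t = tpow E0' t 0 0 *: (tpow E0 t : 'rV[k]_N.+1).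
    apply/rowP => i; rewrite !mxE -big_split; apply: eq_bigr => j _.
    have -> : E0 i j = E0' i j - E0' 0 j by rewrite mxE.
    by rewrite /= -expfzDr // addrCA subrr addr0.
  move=> x; split; apply: zclosure_scale => _ [t ht ->].
    exists (tpow E0' t 0 0)^-1; first by rewrite invr_eq0 tpow_torus.
    have nz := tpow_torus E0' ht 0.
    rewrite [X in _ *: X]c0 // scalerA mulVf // scale1r EE tpowM //.
    by exists (tpow Q t) => //; apply: tpow_torus.
  have [u hu <-] := surj t ht; exists (tpow E0' u 0 0); first exact: tpow_torus.
  by exists u => //; rewrite [RHS]c0 // EE tpowM.
have {YA} : linearly_equivalent Y (zclosure (torus_orbit E)).
  apply: linearly_equivalent_trans YA (linearly_equivalent_eq _) => x.
  by rewrite tE oE.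
move=> [H [G [h1 h2]]].
pose B : 'M[int]_(r, 1 + N) := row_mx (- (B1 *m const_mx 1)) B1.
have B'E : B *m E = 1%:M by rewrite mul_row_col mulmx0 add0r.
have Bs : B *m (const_mx 1 : 'cV_(1 + N)) = 0.
  rewrite -col_mx_const mul_row_col mulNmx -mulmxA.
  have -> : (const_mx 1 : 'cV[int]_N) *m (const_mx 1 : 'cV_1) = const_mx 1.
    by apply/matrixP => i j; rewrite !mxE big_ord1 !mxE mulr1.
  by rewrite addNr.
exists N, r, E, B, G, H.
have GH : G *m H = 1%:M.
  apply: (torus_orbit_span Einj) => x ox; rewrite mulmx1 mulmxA.
  have [] := h2 x => //; apply: sub_zclosure => //; exact: (torus_orbit_nz (0 : 'I_(1 + N))) ox.
split=> //; last by move=> x /h2[].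
split=> //.
by apply/rowP => j; rewrite !mxE; case: splitP => // i; rewrite mxE.
Qed.

End ToricNormalForm.

(** * Differentials of polynomials *)

Section Differential.
Variable k : closedFieldType.
Variable r : nat.

Definition differential (F : {mpoly k[r]}) (x v : 'rV[k]_r) : k :=
  \sum_(i < r) (F^`M(i)).@[x 0] * v 0 i.

Lemma differentialD F G x v : differential (F + G) x v = differential F x v + differential G x v.
Proof.
by rewrite /differential -big_split; apply: eq_bigr => i _; rewrite mderivD mevalD mulrDl.
Qed.

Lemma differentialB F G x v : differential (F - G) x v = differential F x v - differential G x v.
Proof.
by rewrite /differential -sumrB; apply: eq_bigr => i _; rewrite mderivB mevalB mulrBl.
Qed.

Lemma differentialM F G x v :
  differential (F * G) x v =
    differential F x v * G.@[x 0] + F.@[x 0] * differential G x v.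
Proof.
rewrite /differential mulr_suml mulr_sumr -big_split; apply: eq_bigr => i _ /=.
by rewrite mderivM mevalD !mevalM mulrDl mulrAC -!mulrA.
Qed.

Lemma differential_exp F n x v :
  differential (F ^+ n) x v = n%:R * F.@[x 0] ^+ n.-1 * differential F x v.
Proof.
elim: n => [|n IH].
  rewrite expr0 !mul0r /differential big1 // => i _.
  by rewrite -[1]/(1%:MP) mderivC meval0 mul0r.
rewrite exprS differentialM IH /= rmorphXn; case: n {IH} => [|n] /=.
  by rewrite !expr0; ring.
by rewrite -[n.+2]addn1 natrD exprS; ring.
Qed.

Lemma differential_X i x v : differential 'X_i x v = v 0 i.
Proof.
rewrite /differential (bigD1 i) //= big1 ?addr0 => [|j ji]; rewrite mderivX mnm1E.
  have -> : (U_(i) - U_(i))%MM = 0%MM :> 'X_{1..r}.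
    by apply/mnmP => j; rewrite mnmBE subnn mnm0E.
  by rewrite eqxx scale1r mpolyX0 meval1 mul1r.
by rewrite eq_sym (negbTE ji) scale0r meval0 mul0r.
Qed.

Definition linform (c : 'cV[k]_r) : {mpoly k[r]} := \sum_i c i 0 *: 'X_i.

Lemma linform_homog c : linform c \is 1.-homog.
Proof.
rewrite /linform; apply: rpred_sum => i _; apply: rpredZ.
by rewrite dhomogX /= mdeg1.
Qed.

Lemma linform_eval c (x : 'rV[k]_r) : (linform c).@[x 0] = (x *m c) 0 0.
Proof.
rewrite /linform raddf_sum mxE; apply: eq_bigr => i _ /=.
by rewrite mevalZ mevalXU mulrC.
Qed.

Lemma differential_linform c x v : differential (linform c) x v = (v *m c) 0 0.
Proof.
have diff0 : differential 0 x v = 0.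
  by rewrite /differential big1 // => i _; rewrite mderiv0 meval0 mul0r.
rewrite /linform
  (big_morph (fun F => differential F x v) (fun F G => differentialD F G x v) diff0) mxE.
apply: eq_bigr => j _; rewrite mulrC -[in RHS](differential_X j x v) /differential mulr_sumr.
by apply: eq_bigr => i _; rewrite mderivZ mevalZ mulrA.
Qed.

(** The chain rule, applied to a curve on which [F] is identically zero. *)
Lemma differential_curve F (g : 'I_r -> {poly k}) z (x v : 'rV[k]_r) :
  curve F g = 0 -> (forall i, (g i).[z] = x 0 i) -> (forall i, (g i)^`().[z] = v 0 i) ->
  differential F x v = 0.
Proof.
move=> F0 gx gv; rewrite -[RHS](horner0 z) -[in RHS](deriv0 k) -F0 deriv_curve.
apply: eq_bigr => i _; rewrite gv; congr (_ * _).
exact: meval_eq.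
Qed.

Lemma curve_vanish F (g : 'I_r -> {poly k}) :
  (forall z, z != 0 -> F.@[fun i => (g i).[z]] = 0) -> curve F g = 0.
Proof.
move=> h; apply/eqP/negPn/negP => n0.
have [z] := nonroot (mulf_neq0 n0 (negbT (polyX_eq0 k))).
rewrite hornerM hornerX mulf_eq0 negb_or => /andP[nz z0].
by move: nz; rewrite horner_curve h ?eqxx.
Qed.

(** The Euler relation, read off from the line through the origin and [x]. *)
Lemma differential_euler d F (x : 'rV[k]_r) :
  F \is d.-homog -> F.@[x 0] = 0 -> differential F x x = 0.
Proof.
move=> hF Fx; apply: (@differential_curve F (fun i => x 0 i *: 'X) 1).
- apply: curve_vanish => z _.
  have := form_homogeneous z x (form_poly hF); rewrite /= Fx mulr0 => <-.
  by apply: meval_eq => i; rewrite mxE hornerZ hornerX mulrC.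
- by move=> i; rewrite hornerZ hornerX mulr1.
- by move=> i; rewrite derivZ derivX hornerZ hornerC mulr1.
Qed.

Lemma form_mderiv d (F : {mpoly k[r]}) i : F \is d.-homog ->
  form d.-1 (fun x : 'rV[k]_r => (F^`M(i)).@[x 0]).
Proof.
move=> hF; apply: form_poly; apply/dhomogP => m.
rewrite mcoeff_msupp mcoeff_mderiv => h.
have hm : (m + U_(i))%MM \in msupp F.
  by rewrite mcoeff_msupp; apply: contraNneq h => ->; rewrite mul0rn.
have : mdeg (m + U_(i))%MM = d := dhomogP _ _ _ hF _ hm.
by rewrite mdegD mdeg1 addn1 => <-.
Qed.

End Differential.

(** * Pluecker coordinates of the span of a point and a coordinate subspace *)

Section Pluecker.
Variable k : closedFieldType.
Variables n R : nat.

(** A basis of the span of the coordinate subspace [k^n] and [(0, w)], in the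
    order for which the nonzero maximal minors are the entries of [w], without
    signs. *)
Definition join_basis (w : 'rV[k]_R) : 'M[k]_(n.+1, n + R) :=
  \matrix_(a, b) match split b with
                 | inl i => (a == i :> nat)%:R
                 | inr j => (a == n :> nat)%:R * w 0 j end.

Lemma join_basisl w a i : join_basis w a (lshift R i) = (a == i :> nat)%:R.
Proof. by rewrite mxE (unsplitK (inl i)). Qed.

Lemma join_basisr w a j : join_basis w a (rshift n j) = (a == n :> nat)%:R * w 0 j.
Proof. by rewrite mxE (unsplitK (inr j)). Qed.

Lemma mul_join_basis (c : 'rV[k]_n.+1) w :
  c *m join_basis w = row_mx (\row_i c 0 (widen_ord (leqnSn n) i)) (c 0 ord_max *: w).
Proof.
apply/rowP => b; rewrite -[b]splitK; case: (split b) => i /=.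
  rewrite row_mxEl !mxE (bigD1 (widen_ord (leqnSn n) i)) //= big1 ?addr0.
    by rewrite join_basisl eqxx mulr1.
  by move=> a ai; rewrite join_basisl -[a == i :> nat]/(a == widen_ord (leqnSn n) i)
    (negbTE ai) mulr0.
rewrite row_mxEr !mxE (bigD1 ord_max) //= big1 ?addr0.
  by rewrite join_basisr eqxx mul1r.
by move=> a ai; rewrite join_basisr -[a == n :> nat]/(a == ord_max) (negbTE ai) mul0r mulr0.
Qed.

Lemma sub_join_basis (v : 'rV[k]_(n + R)) w :
  reflect (exists c, rsubmx v = c *: w) (v <= join_basis w)%MS.
Proof.
apply: (iffP submxP) => [[c ->]|[c hc]].
  by exists (c 0 ord_max); rewrite mul_join_basis row_mxKr.
exists (\row_a if unlift ord_max a is Some i then lsubmx v 0 i else c).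
rewrite mul_join_basis -[LHS]hsubmxK hc; congr row_mx.
  apply/rowP => i; rewrite [RHS]mxE.
  have -> : widen_ord (leqnSn n) i = lift ord_max i.
    by apply: val_inj; rewrite /= /bump leqNgt ltn_ord.
  by rewrite [RHS]mxE liftK.
by rewrite mxE unlift_none.
Qed.

Lemma join_basis_free w : w != 0 -> row_free (join_basis w).
Proof.
move=> w0; apply: inj_row_free => c; rewrite mul_join_basis => h.
have /rowP h1 : \row_i c 0 (widen_ord (leqnSn n) i) = 0.
  by rewrite -[LHS](row_mxKl _ (c 0 ord_max *: w)) h linear0.
have /eqP : c 0 ord_max *: w = 0.
  by rewrite -[LHS](row_mxKr (\row_i c 0 (widen_ord (leqnSn n) i))) h linear0.
rewrite scaler_eq0 (negbTE w0) orbF => /eqP h2.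
apply/rowP => a; rewrite [RHS]mxE; have [an|an] := ltnP a n.
  have := h1 (Ordinal an); rewrite !mxE => <-; congr (c _ _); exact: val_inj.
rewrite -h2; congr (c _ _); apply: val_inj => /=.
by apply/eqP; rewrite eqn_leq an andbT -ltnS.
Qed.

Definition join_space (w : 'rV[k]_R) : {vspace 'rV[k]_(n + R)} :=
  limg (linfun (mulmxr (join_basis w) : 'rV[k]_n.+1 -> 'rV[k]_(n + R))).

Lemma mem_join_space v w : v \in join_space w <-> exists c, rsubmx v = c *: w.
Proof.
split=> [/memv_imgP[c _ ->]|/sub_join_basis/submxP[c ->]].
  by rewrite lfunE /= mul_join_basis row_mxKr; exists (c 0 ord_max).
by apply/memv_imgP; exists c; rewrite ?memvf // lfunE.
Qed.

Lemma dim_join_space w : w != 0 -> \dim (join_space w) = n.+1.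
Proof.
move=> w0; rewrite limg_dim_eq; first by rewrite dimvf dim_matrix mul1r.
apply/eqP; rewrite -subv0; apply/subvP => c; rewrite memv_cap memv_ker lfunE /=.
rewrite memv0 => /andP[_ /eqP h]; apply/eqP/(row_free_inj (join_basis_free w0)).
by rewrite /= h mul0mx.
Qed.

Definition minor_mx (J : 'I_(pluecker_size n.+1 (n + R))) (B : 'M[k]_(n.+1, n + R)) : 'M[k]_n.+1 :=
  colsub (val (enum_val J : increasing_map n.+1 (n + R))) B.

Definition pluecker_mx : 'M[k]_(R, pluecker_size n.+1 (n + R)) :=
  \matrix_(j, J) \det (minor_mx J (join_basis (delta_mx 0 j))).

(** The minors are linear in the last row of the matrix, whose only free entries
    are those of [w]. *)
Lemma minor_join_basis w J : \det (minor_mx J (join_basis w)) = (w *m pluecker_mx) 0 J.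
Proof.
rewrite mxE (expand_det_row _ ord_max).
have hmax b : minor_mx J (join_basis w) ord_max b =
    \sum_j w 0 j * minor_mx J (join_basis (delta_mx 0 j)) ord_max b.
  rewrite mxE; under eq_bigr => j _ do rewrite [minor_mx _ _ _ _]mxE.
  set c := (fun_of_fin _ _); rewrite -[c]splitK; case: (split c) => i /=.
    rewrite join_basisl (gtn_eqF (ltn_ord i)) big1 // => j _.
    by rewrite join_basisl (gtn_eqF (ltn_ord i)) mulr0.
  rewrite join_basisr eqxx mul1r (bigD1 i) //= big1 ?addr0 => [|j ji]; rewrite join_basisr.
    by rewrite !mxE !eqxx !mulr1.
  by rewrite mxE [i == j]eq_sym (negbTE ji) andbF !mulr0.
have hcof w' b : cofactor (minor_mx J (join_basis w')) ord_max b =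
    cofactor (minor_mx J (join_basis w)) ord_max b.
  rewrite /cofactor; congr (_ * \det _); apply/matrixP => a c.
  rewrite !mxE; case: (split _) => // j.
  by rewrite /= /bump leqNgt ltn_ord (ltn_eqF (ltn_ord a)) !mul0r.
under eq_bigr => b _ do rewrite hmax mulr_suml.
rewrite exchange_big; apply: eq_bigr => j _ /=.
rewrite mxE (expand_det_row _ ord_max) mulr_sumr; apply: eq_bigr => b _.
by rewrite (hcof (delta_mx 0 j)) -mulrA.
Qed.

Definition last_fun (j : 'I_R) : {ffun 'I_n.+1 -> 'I_(n + R)} :=
  [ffun a => if unlift ord_max a is Some i then lshift R i else rshift n j].

Lemma last_fun_val j a : last_fun j a = (if (a < n)%N then val a else (n + j)%N) :> nat.
Proof.
rewrite ffunE; case: unliftP => [i ->|->] /=; last by rewrite ltnn.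
have bE : bump n i = i by rewrite /bump leqNgt ltn_ord.
by rewrite bE ltn_ord.
Qed.

Lemma last_fun_incr j :
  [forall a : 'I_n.+1, forall b : 'I_n.+1, (a < b)%N ==> (last_fun j a < last_fun j b)%N].
Proof.
apply/forallP => a; apply/forallP => b; apply/implyP => ab.
rewrite !last_fun_val; have := ltn_ord b; rewrite ltnS => bn.
have an : (a < n)%N by apply: leq_trans bn.
rewrite an; case: (ltnP b n) => // _.
exact: (leq_trans an (leq_addr _ _)).
Qed.

Definition last_map j : increasing_map n.+1 (n + R) := exist _ (last_fun j) (last_fun_incr j).

Definition pluecker_inv : 'M[k]_(pluecker_size n.+1 (n + R), R) :=
  \matrix_(J, j) (J == enum_rank (last_map j))%:R.

Lemma mul_pluecker_inv (w : 'rV[k]_(pluecker_size n.+1 (n + R))) j :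
  (w *m pluecker_inv) 0 j = w 0 (enum_rank (last_map j)).
Proof.
rewrite mxE (bigD1 (enum_rank (last_map j))) //= big1 ?addr0 => [|J nJ].
  by rewrite mxE eqxx mulr1.
by rewrite mxE (negbTE nJ) mulr0.
Qed.

(** The columns of the first block together with the j-th column of the second
    one form a minor equal to [w_j], so [w] is recovered from the Pluecker
    coordinates. *)
Lemma pluecker_mxK : pluecker_mx *m pluecker_inv = 1%:M.
Proof.
apply/row_matrixP => i; rewrite row_mul row1 rowE; apply/rowP => j.
rewrite mul_pluecker_inv -minor_join_basis; set w := delta_mx 0 i.
have -> : minor_mx (enum_rank (last_map j)) (join_basis w) =
    diag_mx (\row_a if (a < n)%N then 1 else w 0 j).
  apply/matrixP => a b; rewrite !mxE enum_rankK /=.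
  rewrite ffunE; case: unliftP => [c ->|->].
    have bE : bump n c = c by rewrite /bump leqNgt ltn_ord.
    rewrite (unsplitK (inl c)) -[a == lift _ _]/(a == bump n c :> nat) /= bE.
    by case: (a =P c :> nat) => [->|_]; rewrite ?ltn_ord ?mulr1n ?mulr0n.
  rewrite (unsplitK (inr j)) -[a == ord_max]/(a == n :> nat) /=.
  case: (a =P n :> nat) => [->|_]; last by rewrite mul0r mulr0n.
  by rewrite ltnn mul1r mulr1n mxE eqxx.
rewrite det_diag (bigD1 ord_max) //= big1 ?mulr1 => [|a an]; first by rewrite mxE /= ltnn mxE.
rewrite mxE ltn_neqAle -ltnS ltn_ord andbT.
by rewrite -[a == n :> nat]/(a == ord_max) an.
Qed.

Lemma vspace_matrix r d (U : {vspace 'rV[k]_r}) : \dim U = d ->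
  exists V : 'M[k]_(d, r), [/\ row_free V, forall a, row a V = (vbasis U)`_a &
    forall v, v \in U <-> (v <= V)%MS].
Proof.
move=> dU; exists (\matrix_(a, b) (vbasis U)`_a 0 b); set V := (\matrix_(a, b) _).
have rV a : row a V = (vbasis U)`_a by apply/rowP => b; rewrite !mxE.
split=> //.
  apply: inj_row_free => c cV; apply/rowP => a; rewrite [RHS]mxE.
  have fr := basis_free (vbasisP U).
  have fr' : free (tcast dU (vbasis U)) by rewrite val_tcast.
  move/freeP: fr' => /(_ (fun a => c 0 a)); apply.
  rewrite -[RHS]cV mulmx_sum_row; apply: eq_bigr => b _.
  by rewrite rV val_tcast.
move=> v; split=> [vU|/submxP[c ->]].
  rewrite (coord_vbasis vU); apply: summx_sub => i _; apply: scalemx_sub.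
  have id : (i < d)%N by rewrite -dU.
  by rewrite -(rV (Ordinal id)) row_sub.
rewrite mulmx_sum_row; apply: memv_suml => a _; apply: memvZ.
by rewrite rV vbasis_mem // mem_nth // size_tuple dU.
Qed.

(** Up to scaling, the Pluecker coordinates do not depend on the basis; the
    factor is the determinant of the base change. *)
Lemma pluecker_join (U : {vspace 'rV[k]_(n + R)}) w : w != 0 ->
  (forall v, v \in U -> exists c, rsubmx v = c *: w) -> \dim U = n.+1 ->
  exists2 c, c != 0 & pluecker n.+1 U = c *: (w *m pluecker_mx).
Proof.
move=> w0 hU dU; have [V [Vf rV memV]] := vspace_matrix dU.
have VB : (V <= join_basis w)%MS.
  by apply/row_subP => a; apply/sub_join_basis/hU/memV/row_sub.
have [P VP] := submxP VB.
have P0 : \det P != 0.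
  rewrite -unitfE -unitmxE -row_free_unit; apply: inj_row_free => c cP.
  by apply: (row_free_inj Vf); rewrite /= VP mulmxA cP !mul0mx.
exists (\det P) => //; apply/rowP => J; rewrite [LHS]mxE [RHS]mxE.
rewrite -minor_join_basis -det_mulmx; congr (\det _).
apply/matrixP => a b; rewrite mxE -rV VP !mxE; apply: eq_bigr => c _.
by rewrite [minor_mx _ _ _ _]mxE.
Qed.

End Pluecker.

(** * The kernel of a matrix with one more column than rows *)

Section KernelVector.
Variable k : closedFieldType.

(** Cramer: the entries are the maximal minors of [M] up to sign, obtained by
    adding a unit vector on top of [M]. So the kernel of a matrix [M] of full
    rank is spanned by a vector of polynomials in its entries. *)
Definition signed_minors q (M : 'M[k]_(q, q.+1)) : 'rV[k]_(q.+1) :=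
  \row_j \det (col_mx (delta_mx 0 j : 'rV_q.+1) M : 'M_(1 + q)).

Lemma det_top_row q (c : 'rV[k]_(q.+1)) (M : 'M[k]_(q, q.+1)) :
  \det (col_mx c M : 'M_(1 + q)) = \sum_j c 0 j * signed_minors M 0 j.
Proof.
rewrite (expand_det_row _ (lshift q 0)).
have top (d : 'rV[k]_(q.+1)) j : (col_mx d M : 'M_(1 + q)) (lshift q 0) j = d 0 j.
  exact: (col_mxEu d M 0 j).
have cof (d : 'rV[k]_(q.+1)) j : cofactor (col_mx d M : 'M_(1 + q)) (lshift q 0) j =
    cofactor (col_mx c M : 'M_(1 + q)) (lshift q 0) j.
  rewrite /cofactor; congr (_ * \det _); apply/matrixP => a b.
  rewrite !mxE; case: splitP => [e|e ee]; rewrite ?mxE //.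
  by rewrite (ord1 e) /= /bump.
apply: eq_bigr => j _; rewrite top; congr (_ * _).
rewrite mxE (expand_det_row _ (lshift q 0)) (bigD1 j) //= big1 ?addr0 => [|b bj].
  by rewrite (top (delta_mx 0 j) j) mxE !eqxx mul1r (cof (delta_mx 0 j)).
by rewrite (top (delta_mx 0 j) b) mxE (negbTE bj) andbF mul0r.
Qed.

Lemma signed_minors_ker q (M : 'M[k]_(q, q.+1)) : signed_minors M *m M^T = 0.
Proof.
apply/rowP => a; rewrite [RHS]mxE mxE.
transitivity (\det (col_mx (row a M) M : 'M_(1 + q))).
  by rewrite det_top_row; apply: eq_bigr => j _; rewrite !mxE mulrC.
apply: (@determinant_alternate _ _ _ (lshift q 0) (rshift 1 a)) => // b.
have e : row a M 0 b = M a b by rewrite mxE.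
exact: (etrans (col_mxEu _ M 0 b) (etrans e (esym (col_mxEd _ M a b)))).
Qed.

(** Both sides come from the determinant of [M] with the row [w_l e_j - w_j e_l]
    on top; it vanishes because all its rows annihilate [w]. *)
Lemma signed_minors_prop q (M : 'M[k]_(q, q.+1)) (w : 'rV[k]_q.+1) j l : w *m M^T = 0 ->
  signed_minors M 0 j * w 0 l = signed_minors M 0 l * w 0 j.
Proof.
move=> wM; have [->|w0] := eqVneq w 0; first by rewrite !mxE !mulr0.
pose c : 'rV[k]_(1 + q) := w 0 l *: delta_mx 0 j - w 0 j *: delta_mx 0 l.
have cw : c *m w^T = 0.
  apply/rowP => i; rewrite /c mulmxBl -!scalemxAl -!rowE !mxE ord1.
  by rewrite mulrC subrr.
pose A : 'M[k]_(1 + q) := col_mx c M.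
have A0 : A *m w^T = 0.
  by rewrite /A mul_col_mx cw -[M *m _]trmxK trmx_mul trmxK wM trmx0 col_mx0.
have : \det A = 0.
  apply/eqP/negPn/negP; rewrite -unitfE -unitmxE => uA; case/eqP: w0.
  by rewrite -[w]trmxK -[w^T](mulKmx uA) A0 mulmx0 trmx0.
rewrite /A det_top_row.
have -> : \sum_i c 0 i * signed_minors M 0 i =
    w 0 l * signed_minors M 0 j - w 0 j * signed_minors M 0 l.
  have := congr1 (fun z : 'M_(1,1) => z 0 0)
    (mulmxBl (w 0 l *: delta_mx 0 j) (w 0 j *: delta_mx 0 l) (signed_minors M)^T).
  rewrite -!scalemxAl -!rowE !mxE => <-; apply: eq_bigr => i _.
  by rewrite !mxE.
by move/eqP; rewrite subr_eq0 mulrC => /eqP ->; rewrite mulrC.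
Qed.

Lemma row_free_extend q r (M : 'M[k]_(q, r)) (c : 'rV[k]_r) :
  row_free M -> ~~ (c <= M)%MS -> row_free (col_mx c M).
Proof.
move=> fM cM; apply: inj_row_free => v; rewrite -[v]hsubmxK mul_row_col => h.
have l0 : lsubmx v = 0.
  rewrite [lsubmx v]mx11_scalar; set a := _ 0 0.
  have [->|a0] := eqVneq a 0; first by rewrite raddf0.
  have e : a *: c = - (rsubmx v *m M).
    by apply/eqP; rewrite -addr_eq0 -mul_scalar_mx -mx11_scalar h.
  case/negP: cM; rewrite -[c]scale1r -(mulVf a0) -scalerA e -mulNmx.
  by rewrite scalemx_sub // submxMl.
move: h; rewrite l0 mul0mx add0r -(mul0mx _ M) => /(row_free_inj fM) ->.
by rewrite row_mx0.
Qed.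

Lemma signed_minors_neq0 q (M : 'M[k]_(q, q.+1)) : row_free M -> signed_minors M != 0.
Proof.
move=> fM; apply: NNPP => /negP/negPn/eqP m0.
have sub j : ((delta_mx 0 j : 'rV_q.+1) <= M)%MS.
  apply: NNPP => /negP nj; have f := row_free_extend fM nj.
  have : \det (col_mx (delta_mx 0 j) M : 'M_(1 + q)) != 0.
    by rewrite -unitfE -unitmxE -row_free_unit.
  by have /rowP/(_ j) := m0; rewrite !mxE => ->; rewrite eqxx.
have : (1%:M <= M)%MS by apply/row_subP => i; rewrite row1.
by move/mxrankS; rewrite mxrank1 => /leq_trans/(_ (rank_leq_row _)); rewrite ltnn.
Qed.

Lemma form_det r q (d : 'I_q -> nat) (A : 'I_q -> 'I_q -> 'rV[k]_r -> k) :
  (forall i j, form (d i) (A i j)) ->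
  form (\sum_i d i)%N (fun z => \det (\matrix_(i, j) A i j z)).
Proof.
move=> hA.
apply: (@form_ext _ _ _ (fun z => \sum_(s : 'S_q) (-1) ^+ s * \prod_i A i (s i) z)).
  by move=> z; apply: eq_bigr => s _; congr (_ * _); apply: eq_bigr => i _; rewrite mxE.
by apply: form_sum => s _; apply: form_scale; apply: form_prod.
Qed.

Lemma form_signed_minors r q (d : 'I_q -> nat) (M : 'I_q -> 'I_q.+1 -> 'rV[k]_r -> k) j :
  (forall i l, form (d i) (M i l)) ->
  form (\sum_i d i)%N (fun z => signed_minors (\matrix_(i, l) M i l z) 0 j).
Proof.
move=> hM.
pose d' (i : 'I_(1 + q)) := match split i with inl _ => 0%N | inr i' => d i' end.
pose A (i l : 'I_(1 + q)) (z : 'rV[k]_r) : k :=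
  match split i with inl _ => (l == j)%:R | inr i' => M i' l z end.
have -> : (\sum_i d i = \sum_i d' i)%N.
  rewrite big_split_ord /= big_ord1 {1}/d' (unsplitK (inl _)) add0n.
  by apply: eq_bigr => i _; rewrite /d' (unsplitK (inr i)).
apply: (@form_ext _ _ _ (fun z => \det (\matrix_(i, l) A i l z))).
  move=> z; rewrite mxE; congr (\det _); apply/matrixP => a b.
  by rewrite !mxE /A; case: (split a) => i; rewrite !mxE // ord1 eqxx.
apply: form_det => i l; rewrite /d' /A; case: (split i) => i'; last exact: hM.
exact: form_const.
Qed.

End KernelVector.

(** * Tangent spaces of the constructed variety *)

Lemma mulmx_col (K : pzRingType) a b c (A : 'M[K]_(a, b)) (B : 'M[K]_(b, c)) i :
  A *m col i B = col i (A *m B).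
Proof. by rewrite !colE mulmxA. Qed.

Section FrobeniusVariety.
Variables (k : closedFieldType) (p : nat).
Hypothesis hp : p \in [pchar k].
Variables (n N R' : nat).
Local Notation R := R'.+1.
Variables (u : 'M[int]_n) (C : 'M[int]_(N.+1, n)).
Variables (G : 'M[k]_(N.+1, R)) (H : 'M[k]_(R, N.+1)).
Hypothesis hu : (\det u)%:~R != 0 :> k.
Hypothesis C0 : row 0 C = 0.
Hypothesis GH : G *m H = 1%:M.

(** The rows of [C] are the exponents of the prescribed image; the factor [p]
    makes the second block a Frobenius twist, with zero derivatives. The
    matrices [G] and [H] pass from toric coordinates to the given homogeneous
    coordinates and back. *)
Definition toric_coord (s : 'rV[k]_n) : 'rV[k]_N.+1 := tpow (p%:Z *: C) s.
Definition base_coord (s : 'rV[k]_n) : 'rV[k]_R := toric_coord s *m G.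
Definition frob_point (s : 'rV[k]_n) : 'rV[k]_(n + R) := row_mx (tpow u s) (base_coord s).
Definition frob_points : pset k (n + R) := fun x => exists2 s, torus s & x = frob_point s.
Definition frob_variety := zclosure frob_points.

Lemma base_coordK s : base_coord s *m H = toric_coord s.
Proof. by rewrite /base_coord -mulmxA GH mulmx1. Qed.

Lemma toric_coord0 s : toric_coord s 0 0 = 1.
Proof. by apply: tpow_zero_row; rewrite linearZ /= C0 scaler0. Qed.

Lemma base_coord_neq0 s : base_coord s != 0.
Proof.
apply/eqP => h; have := toric_coord0 s; rewrite -base_coordK h mul0mx mxE.
by move/esym/eqP; rewrite oner_eq0.
Qed.

Lemma frob_point_neq0 s : frob_point s != 0.
Proof.
apply/eqP => h; case/eqP: (base_coord_neq0 s).
by rewrite -[LHS](row_mxKr (tpow u s)) -/(frob_point s) h linear0.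
Qed.

Lemma frob_point_in s : torus s -> frob_variety (frob_point s).
Proof. by move=> hs; apply: sub_zclosure; [exact: frob_point_neq0|exists s]. Qed.

Lemma hideal_frob_point F s : hideal frob_variety F -> torus s -> F.@[frob_point s 0] = 0.
Proof. by move=> [_ h] hs; apply: h; apply: frob_point_in. Qed.

Lemma p_gt0 : (0 < p)%N.
Proof. exact: prime_gt0 (pcharf_prime hp). Qed.

Lemma tpow_const a (M : 'M[int]_(a, 1)) (z : k) j : tpow M (const_mx z) 0 j = z ^ M j 0.
Proof. by rewrite mxE big_ord1 mxE. Qed.

(** Since [u] is invertible in [k], its adjugate gives a one-parameter subgroup
    that moves the i-th coordinate of the first block and fixes the other ones.
    It moves the second block through p-th powers, whose derivative is zero. So
    the i-th unit vector is tangent. *)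
Lemma partial_frob_point F s i : hideal frob_variety F -> torus s ->
  (F^`M(lshift R i)).@[frob_point s 0] = 0.
Proof.
move=> hF hs; pose D := \det u; pose L := \adj u.
(* The shift [K] is a multiple of [p], so it disappears from the derivatives. *)
pose K' := (`|D| + exponent_bound (C *m L))%N; pose K := (p * K')%N.
pose ey (j : 'I_n) : int := D *+ (j == i).
pose ex (l : 'I_N.+1) : int := p%:Z * (C *m L) l i.
have eyK j : (`|ey j| <= K)%N.
  rewrite /ey /K /K'; have := p_gt0; case: eqP => _; rewrite ?mulr1n ?mulr0n; nia.
have exK l : (`|ex l| <= K)%N.
  rewrite /ex /K /K' abszM leq_mul2l; apply/orP; right.
  exact: leq_trans (exponent_bound_le _ _ _) (leq_addl _ _).
pose g (b : 'I_(n + R)) : {poly k} := match split b with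
  | inl j => tpow u s 0 j *: 'X^`|(ey j + K%:Z)%R|
  | inr m => \sum_l (toric_coord s 0 l * G l m) *: 'X^`|(ex l + K%:Z)%R| end.
have gl j : g (lshift R j) = tpow u s 0 j *: 'X^`|(ey j + K%:Z)%R|.
  by rewrite /g (unsplitK (inl j)).
have gr m : g (rshift n m) = \sum_l (toric_coord s 0 l * G l m) *: 'X^`|(ex l + K%:Z)%R|.
  by rewrite /g (unsplitK (inr m)).
have p0 : p%:R = 0 :> k by apply: pcharf0.
have K0 : K%:Z%:~R = 0 :> k by rewrite -pmulrn natrM p0 mul0r.
have uL j : (u *m L) j i = ey j by rewrite mul_mx_adj mxE.
have pL l : ((p%:Z *: C) *m L) l i = ex l by rewrite -scalemxAl mxE.
pose s' z := \row_j (s 0 j * tpow (col i L) (const_mx z) 0 j).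
have curveE z : z != 0 -> \row_b (g b).[z] = z ^+ K *: frob_point (s' z).
  move=> z0; have tz : torus (const_mx z : 'rV[k]_1) by move=> j; rewrite mxE.
  have tL := tpow_torus (col i L) tz.
  have E a (M : 'M[int]_(a, n)) j : tpow M (s' z) 0 j = tpow M s 0 j * z ^ (M *m L) j i.
    rewrite /s' tpow_tmul // -tpowM // tpow_const; congr (_ * z ^ _).
    by rewrite mulmx_col mxE.
  apply/rowP => b; rewrite -[b]splitK; case: (split b) => j; rewrite /= [LHS]mxE [RHS]mxE.
    rewrite gl /frob_point row_mxEl E uL hornerZ hornerXn shift_expr //.
    by rewrite mulrCA.
  rewrite gr /frob_point row_mxEr /base_coord mxE horner_sum big_distrr /=; apply: eq_bigr => l _.
  rewrite hornerZ hornerXn shift_expr // /toric_coord E.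
  rewrite pL; move: (z ^+ K) (z ^ ex l) (G l j) (tpow _ s 0 l) => y1 y2 y3 y4.
  by clear; ring.
have F0 : curve F g = 0.
  apply: curve_vanish => z z0.
  have := form_homogeneous (z ^+ K) (frob_point (s' z)).
  have hs' : torus (s' z).
    move=> j; rewrite mxE mulf_neq0 //; apply: tpow_torus => l; by rewrite mxE.
  have [[d hd] _] := hF.
  move=> /(_ _ _ (form_poly hd)); rewrite hideal_frob_point // mulr0 -curveE // => <-.
  by apply: meval_eq => b; rewrite mxE.
have dX (c : k) (e : int) : (`|e| <= K)%N ->
    (c *: 'X^`|(e + K%:Z)%R|)^`().[1] = c * e%:~R.
  move=> eK; rewrite derivZ derivXn hornerZ hornerMn hornerXn expr1n.
  by rewrite pmulrn shift_abs // intrD K0 addr0.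
have g1 b : (g b).[1] = frob_point s 0 b.
  have := curveE 1 (oner_neq0 _); rewrite expr1n scale1r => /rowP/(_ b).
  rewrite mxE => ->; congr (frob_point _ 0 b); apply/rowP => j.
  by rewrite mxE tpow_const exp1rz mulr1.
have := differential_curve (x := frob_point s) (v := \row_b (g b)^`().[1]) F0 g1.
move=> /(_ (fun b => esym (mxE _ _ _ b))); rewrite /differential big_split_ord /=.
rewrite [X in _ + X]big1 ?addr0 => [|m _]; last first.
  rewrite mxE gr (big_morph _ (@derivD _) (deriv0 _)) horner_sum big1 ?mulr0 // => l _.
  by rewrite /= dX // /ex intrM -pmulrn p0 mul0r mulr0.
rewrite (bigD1 i) //= big1 ?addr0 => [|j ji]; last first.
  by rewrite mxE gl dX // /ey (negbTE ji) mulr0n mulr0 mulr0.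
rewrite mxE gl dX // /ey eqxx mulr1n => /eqP; rewrite !mulf_eq0.
by rewrite (negbTE hu) (negbTE (tpow_torus u hs i)) !orbF => /eqP.
Qed.

(** The partial derivatives vanish at the points of the torus and are forms, so
    they vanish everywhere. *)
Lemma partial_frob_variety F x i : hideal frob_variety F -> frob_variety x ->
  (F^`M(lshift R i)).@[x 0] = 0.
Proof.
move=> hF; have [[d hd] _] := hF.
apply: (zclosure_form (form_mderiv (lshift R i) hd)) => _ [s hs ->].
exact: partial_frob_point.
Qed.

Lemma differential_frob_variety F x v : hideal frob_variety F -> frob_variety x ->
  differential F x v = \sum_(j < R) (F^`M(rshift n j)).@[x 0] * v 0 (rshift n j).
Proof.
move=> hF hx; rewrite /differential big_split_ord /= big1 ?add0r // => i _.
by rewrite partial_frob_variety // mul0r.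
Qed.

Lemma tangent_base_coord F s v : hideal frob_variety F -> torus s ->
  (exists c, rsubmx v = c *: base_coord s) -> differential F (frob_point s) v = 0.
Proof.
move=> hF hs [c /rowP hv]; have hx := frob_point_in hs.
have [[d hd] _] := hF.
have e := differential_euler hd (hideal_frob_point hF hs).
rewrite -[RHS](mulr0 c) -[in RHS]e !differential_frob_variety // big_distrr /=.
apply: eq_bigr => j _; move: (hv j); rewrite !mxE => ->.
by rewrite (unsplitK (inr j)) mxE; ring.
Qed.

Definition pos_part (z : int) : nat := if (0 <= z)%R then `|z|%N else 0%N.
Definition neg_part (z : int) : nat := if (0 <= z)%R then 0%N else `|z|%N.

Lemma pos_partE (z : int) (x : k) : x != 0 -> x ^+ pos_part z = x ^+ neg_part z * x ^ z.
Proof.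
move=> x0; rewrite !exprnP -expfzDr //; congr (_ ^ _).
by rewrite /pos_part /neg_part; case: z => m /=; rewrite ?add0r // NegzE addrN.
Qed.

(** The equations that cut out the tangent space: the linear equations of the
    span of the second block, and for every [j] the binomial relation saying
    that a power of the j-th toric coordinate, of exponent prime to [p], is a
    Laurent monomial in the p-th powers of the first block. Only the exponent
    prime to [p] contributes to the differential. *)
Lemma tangent_frob_point s v : torus s ->
  (forall F, hideal frob_variety F -> differential F (frob_point s) v = 0) ->
  exists c, rsubmx v = c *: base_coord s.
Proof.
move=> hs hv; pose L (j : 'I_N.+1) := linform (col_mx (0 : 'cV_n) (col j H)).
have Lx j (x : 'rV[k]_(n + R)) : (L j).@[x 0] = (rsubmx x *m H) 0 j.
  rewrite linform_eval -[x in LHS]hsubmxK mul_row_col mulmx0 add0r mulmx_col mxE //.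
have Ls j : (L j).@[frob_point s 0] = toric_coord s 0 j by rewrite Lx row_mxKr base_coordK.
have dL j : differential (L j) (frob_point s) v = (rsubmx v *m H) 0 j.
  by rewrite differential_linform -[v in LHS]hsubmxK mul_row_col mulmx0 add0r mulmx_col mxE.
have e1 : rsubmx v = rsubmx v *m H *m G.
  apply/eqP; rewrite -subr_eq0; apply/eqP/rowP => m; rewrite [RHS]mxE.
  pose c := col_mx (0 : 'cV[k]_n) (col m (1%:M - H *m G)).
  have E (x : 'rV[k]_(n + R)) : (x *m c) 0 0 = (rsubmx x - rsubmx x *m H *m G) 0 m.
    rewrite -[x in LHS]hsubmxK mul_row_col mulmx0 add0r mulmx_col mxE.
    by rewrite mulmxBr mulmx1 mulmxA.
  rewrite -E -(differential_linform c (frob_point s)); apply: hv; split.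
    by exists 1%N; apply: linform_homog.
  move=> x; apply: (zclosure_form (form_poly (linform_homog c))) => _ [t ht ->].
  by rewrite /= linform_eval E row_mxKr base_coordK subrr mxE.
pose D := \det u; pose DD := `|(D * D)%R|%N.
have DDE : DD%:Z = D * D by rewrite /DD; nia.
have DD0 : DD%:R != 0 :> k by rewrite pmulrn DDE intrM mulf_neq0.
(* The square [DD] of the determinant is positive, and the rows of [ga] express
   its product with [C] in terms of the rows of [u]. *)
pose ga : 'M[int]_(N.+1, n) := D *: (C *m \adj u).
have gaE : ga *m u = DD%:Z *: C.
  by rewrite -scalemxAl -mulmxA mul_adj_mx mul_mx_scalar scalerA -DDE.
pose pm j := (\sum_i pos_part (ga j i))%N; pose nm j := (\sum_i neg_part (ga j i))%N.
pose A j : {mpoly k[n + R]} := (\prod_i 'X_(lshift R i) ^+ neg_part (ga j i)) * L 0 ^+ pm j.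
pose B j : {mpoly k[n + R]} := (\prod_i 'X_(lshift R i) ^+ pos_part (ga j i)) * L 0 ^+ nm j.
have hpow e (F : {mpoly k[n + R]}) : F \is 1.-homog -> F ^+ e \is e.-homog.
  by move=> hF; have := dhomogMn e hF; rewrite mul1n.
have hXp (f : 'I_n -> nat) :
    (\prod_i 'X_(lshift R i) ^+ f i : {mpoly k[n + R]}) \is (\sum_i f i)%N.-homog.
  elim/big_rec2: _ => [|i d F _ hF]; first exact: dhomog1.
  by apply: dhomogM => //; apply: hpow; rewrite dhomogX /= mdeg1.
have hLe j e : L j ^+ e \is e.-homog.
  by apply/hpow/linform_homog.
pose F j := L j ^+ DD * A j ^+ p - L 0 ^+ DD * B j ^+ p.
have As j t : torus t ->
    (A j).@[frob_point t 0] = \prod_i tpow u t 0 i ^+ neg_part (ga j i).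
  move=> ht; rewrite mevalM rmorphXn /= Lx row_mxKr base_coordK toric_coord0 expr1n
    mulr1 rmorph_prod.
  by apply: eq_bigr => i _; rewrite rmorphXn /= mevalXU /frob_point row_mxEl.
have Bs j t : torus t ->
    (B j).@[frob_point t 0] = \prod_i tpow u t 0 i ^+ pos_part (ga j i).
  move=> ht; rewrite mevalM rmorphXn /= Lx row_mxKr base_coordK toric_coord0 expr1n
    mulr1 rmorph_prod.
  by apply: eq_bigr => i _; rewrite rmorphXn /= mevalXU /frob_point row_mxEl.
have AB j t : torus t ->
    (B j).@[frob_point t 0] ^+ p = (A j).@[frob_point t 0] ^+ p * toric_coord t 0 j ^+ DD.
  move=> ht; rewrite As // Bs //.
  under eq_bigr => i _ do rewrite pos_partE ?tpow_torus //.
  rewrite big_split exprMn /=; congr (_ * _).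
  have -> : \prod_i tpow u t 0 i ^ ga j i = tpow (ga *m u) t 0 j by rewrite tpowM // mxE.
  by rewrite gaE /toric_coord !tpow_natmul -!exprM mulnC.
have hF j : hideal frob_variety (F j).
  have homF : F j \is (DD + (nm j + pm j) * p)%N.-homog.
    apply: rpredB; apply: dhomogM (hLe _ _) _; apply: dhomogMn.
      by apply: dhomogM (hXp _) (hLe _ _).
    by rewrite [(nm j + pm j)%N]addnC; apply: dhomogM (hXp _) (hLe _ _).
  split; first by exists (DD + (nm j + pm j) * p)%N.
  move=> x; apply: (zclosure_form (form_poly homF)) => _ [t ht ->] /=.
  rewrite mevalB !mevalM !rmorphXn /= AB // !Lx row_mxKr base_coordK toric_coord0 expr1n mul1r.
  by rewrite mulrC subrr.
pose c : k := (rsubmx v *m H) 0 0; exists c.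
suff e2 : rsubmx v *m H = c *: toric_coord s by rewrite e1 e2 -scalemxAl.
apply/rowP => j; rewrite [RHS]mxE.
have p0 : p%:R = 0 :> k by apply: pcharf0.
have := hv _ (hF j); rewrite differentialB !differentialM
  [differential (A j ^+ p) _ _]differential_exp [differential (B j ^+ p) _ _]differential_exp p0.
rewrite !mul0r !mulr0 !addr0 !differential_exp !dL !rmorphXn /= AB // !Ls toric_coord0
  expr1n mulr1 -/c.
have nA : (A j).@[frob_point s 0] ^+ p != 0.
  by rewrite As // expf_neq0 //; apply/prodf_neq0 => i _; rewrite expf_neq0 // tpow_torus.
have nx : toric_coord s 0 j ^+ DD.-1 != 0 by rewrite expf_neq0 // tpow_torus.
have -> : toric_coord s 0 j ^+ DD = toric_coord s 0 j * toric_coord s 0 j ^+ DD.-1.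
  rewrite -exprS prednK //; move: DD0; case: (DD) => //; by rewrite eqxx.
move=> h; apply/eqP; rewrite -subr_eq0.
(* The p-th powers have zero differential, so only the exponent [DD] is left. *)
have /eqP : DD%:R * (toric_coord s 0 j ^+ DD.-1) * (A j).@[frob_point s 0] ^+ p *
    ((rsubmx v *m H) 0 j - c * toric_coord s 0 j) = 0.
  rewrite -[RHS]h mulrBr -!mulrA; congr (_ * (_ * _) - _ * _); first exact: mulrC.
  by rewrite mulrC -!mulrA mulrCA.
by rewrite !mulf_eq0 (negbTE DD0) (negbTE nx) (negbTE nA).
Qed.

Lemma gauss_frob_point s :
  torus s -> gauss n frob_variety (frob_point s) (join_space n (base_coord s)).
Proof.
move=> hs; split; [exact: frob_point_in| |exact/dim_join_space/base_coord_neq0].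
move=> v; rewrite mem_join_space; split=> [h F hF|h].
  exact: tangent_base_coord.
exact: tangent_frob_point.
Qed.

(** Near a smooth point the Gauss map is given by polynomials. Choose equations
    whose gradients at [x] are independent and as many as possible; by the
    dimension of [U] there are [R'] of them. Their gradients only involve the
    second block, and [mu] is the vector of their maximal minors, which spans
    the kernel at [x] and is proportional to the second block of every point of
    the torus. *)
Lemma gauss_local x U : gauss n frob_variety x U ->
  exists d (mu : 'rV[k]_(n + R) -> 'rV[k]_R),
  [/\ forall j, form d (fun z => mu z 0 j),
      mu x != 0,
      forall s, torus s -> exists c, mu (frob_point s) = c *: base_coord s &
      forall v, v \in U <-> exists c, rsubmx v = c *: mu x].
Proof.
move=> [hx hU dU].
pose Mx q (F : 'I_q -> {mpoly k[n + R]}) (z : 'rV[k]_(n + R)) : 'M[k]_(q, R) :=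
  \matrix_(a, l) (F a)^`M(rshift n l).@[z 0].
pose P q := exists F : 'I_q -> {mpoly k[n + R]},
  (forall a, hideal frob_variety (F a)) /\ row_free (Mx q F x).
(* A maximal family of equations whose gradients at [x] are independent. *)
have [q [[F [hF fF]] maxq]] : exists q, P q /\ ~ P q.+1.
  apply: NNPP => h; have Pq q : P q.
    elim: q => [|q IH]; last by apply: NNPP => nP; apply: h; exists q.
    by exists (fun _ => 0); split=> [[]//|]; rewrite /row_free -leqn0 rank_leq_row.
  have [F [_ /eqP fF]] := Pq R.+1.
  by have := rank_leq_col (Mx _ F x); rewrite fF ltnn.
set M := Mx q F x in fF.
have sub F' : hideal frob_variety F' ->
    (\row_l F'^`M(rshift n l).@[x 0] <= M)%MS.
  move=> hF'; apply: NNPP => /negP nM; apply: maxq.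
  have := row_free_extend fF nM => f.
  pose FF (a : 'I_(1 + q)) := match split a with inl _ => F' | inr a' => F a' end.
  exists FF; split.
    by move=> a; rewrite /FF; case: (@split 1 q a).
  have -> : Mx (1 + q)%N FF x = col_mx (\row_l F'^`M(rshift n l).@[x 0]) M; last exact: f.
  by apply/matrixP => a l; rewrite !mxE /FF; case: (split a) => b; rewrite !mxE.
have differentialM F' v : hideal frob_variety F' ->
    differential F' x v = (rsubmx v *m (\row_l F'^`M(rshift n l).@[x 0])^T) 0 0.
  move=> hF'; rewrite differential_frob_variety // mxE; apply: eq_bigr => l _.
  by rewrite !mxE mulrC.
have memU v : v \in U <-> rsubmx v *m M^T = 0.
  split=> [/hU h|h]; last first.
    apply/hU => F' hF'; rewrite -/(differential F' x v) differentialM //.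
    by have /submxP[D ->] := sub _ hF'; rewrite trmx_mul mulmxA h mul0mx mxE.
  apply/rowP => a; rewrite [RHS]mxE -[RHS](h _ (hF a)) -/(differential _ x v) differentialM //.
  by rewrite !mxE; apply: eq_bigr => l _; rewrite !mxE.
(* The space [U] is the kernel of a matrix of rank [q] with [n + R] rows. *)
have qR : q = R'.
  have [V [Vf _ memV]] := vspace_matrix dU.
  pose K : 'M[k]_(n + R, q) := col_mx 0 M^T.
  have kerE v : v *m K = rsubmx v *m M^T.
    by rewrite -[v in LHS]hsubmxK mul_row_col mulmx0 add0r.
  have rK : \rank K = q.
    by rewrite rank_col_0mx mxrank_tr; apply/eqP.
  have : \rank V = \rank (kermx K).
    apply: eqmx_rank; apply/andP; split; apply/row_subP => a.
      by apply/sub_kermxP; rewrite kerE; apply/memU/memV/row_sub.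
    apply/memV/memU; rewrite -kerE; apply/sub_kermxP; exact: row_sub.
  rewrite mxrank_ker rK (eqP Vf).
  have := rank_leq_col M; rewrite (eqP fF); lia.
subst q.
have /fin_all_exists[d hd] : forall a, exists d, F a \is d.-homog.
  by move=> a; case: (hF a).
exists (\sum_a (d a).-1)%N, (fun z => signed_minors (Mx R' F z)).
have mem v : v \in U <-> exists c, rsubmx v = c *: signed_minors M.
  rewrite memU; split=> [h|[c ->]]; last by rewrite -scalemxAl signed_minors_ker scaler0.
  have m0 := signed_minors_neq0 fF.
  have [j mj] : exists j, signed_minors M 0 j != 0.
    apply: NNPP => nj; case/eqP: m0; apply/rowP => j; rewrite [RHS]mxE.
    by apply/eqP/negPn/negP => mj; apply: nj; exists j.
  exists (rsubmx v 0 j / signed_minors M 0 j); apply/rowP => l; rewrite [RHS]mxE.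
  by apply: (mulfI mj); rewrite (signed_minors_prop _ _ h) mulrA mulrCA mulfV // mulr1 mulrC.
split=> //.
- move=> j; apply: form_signed_minors => a l; apply: form_mderiv; exact: hd.
- exact: signed_minors_neq0.
move=> s hs.
have h : base_coord s *m (Mx R' F (frob_point s))^T = 0.
  apply/rowP => a; rewrite [RHS]mxE.
  rewrite -[RHS](tangent_base_coord (v := row_mx 0 (base_coord s)) (hF a) hs).
    rewrite differential_frob_variety; [|exact: hF|exact: frob_point_in].
    rewrite mxE; apply: eq_bigr => l _; rewrite row_mxEr !mxE mulrC //.
  by exists 1; rewrite row_mxKr scale1r.
have [l xl] : exists l, base_coord s 0 l != 0.
  apply: NNPP => nj; case/eqP: (base_coord_neq0 s); apply/rowP => j; rewrite [RHS]mxE.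
  by apply/eqP/negPn/negP => mj; apply: nj; exists j.
exists (signed_minors (Mx R' F (frob_point s)) 0 l / base_coord s 0 l).
apply/rowP => j; rewrite [RHS]mxE.
by apply: (mulIf xl); rewrite (signed_minors_prop _ _ h) mulrAC mulfVK.
Qed.

End FrobeniusVariety.

(** * Laurent monomials and Frobenius twists as forms *)

Section ShiftedMonomials.
Variable k : closedFieldType.

(** The Laurent monomial of exponents [e], multiplied by the K-th power of the
    product of all coordinates to become a polynomial. *)
Definition shifted_monomial N K (e : 'I_N -> int) (x : 'rV[k]_N) : k :=
  \prod_b x 0 b ^+ `|(e b + K%:Z)%R|.

Lemma form_shifted_monomial N K (e : 'I_N -> int) :
  (forall b, `|e b| <= K)%N -> \sum_b e b = 0 ->
  form (N * K) (shifted_monomial K e).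
Proof.
move=> eK e0.
have -> : (N * K = \sum_(b < N) `|(e b + K%:Z)%R|)%N.
  suff : (N * K)%N%:Z = \sum_(b < N) `|(e b + K%:Z)%R|%N%:Z.
    by rewrite -(big_morph Posz PoszD (erefl _)) => -[].
  under eq_bigr => b _ do rewrite shift_abs //.
  by rewrite big_split /= e0 add0r sumr_const card_ord -mulr_natr natz -PoszM mulnC.
apply: form_prod => b; rewrite -[X in form X]mul1n; apply: form_exp.
exact: form_coord.
Qed.

Lemma shifted_monomialE N K (e : 'I_N -> int) (x : 'rV[k]_N) :
  (forall b, `|e b| <= K)%N -> torus x ->
  shifted_monomial K e x = (\prod_b x 0 b) ^+ K * \prod_b x 0 b ^ e b.
Proof.
move=> eK hx; rewrite -prodrXl -big_split; apply: eq_bigr => b _.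
by rewrite /= shift_expr.
Qed.

(** The relations [E B E = E] between the exponents are binomial equations of
    the closure; where no coordinate vanishes, they allow to solve for the
    parameters [t = x^B]. *)
Lemma open_orbit a b (E : 'M[int]_(a, b)) (B : 'M[int]_(b, a)) i0 (x : 'rV[k]_a) :
  row i0 E = 0 -> B *m E = 1%:M -> B *m const_mx 1 = 0 :> 'cV_b ->
  zclosure (torus_orbit E) x -> torus x ->
  exists c t, [/\ c != 0, torus t & x = c *: tpow E t].
Proof.
move=> E0 BE B1 zx hx; exists (x 0 i0), (tpow B x); split=> //; first exact: tpow_torus.
rewrite -tpowM //; apply/rowP => j; rewrite mxE.
pose e l := (E *m B) j l; pose K := exponent_bound (E *m B).
have eK l : (`|e l| <= K)%N by apply: exponent_bound_le.
have e0 : \sum_l e l = 0.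
  have /colP/(_ j) : E *m B *m const_mx 1 = 0 :> 'cV_a by rewrite -mulmxA B1 mulmx0.
  rewrite [RHS]mxE mxE => h; rewrite -[RHS]h; apply: eq_bigr => l _.
  by rewrite [const_mx _ _ _]mxE mulr1.
(* Both sides of the binomial equation are multiplied by the product of the
   coordinates to the power [K]. *)
have z0 : forall l, (`|(0 : int)| <= K)%N by [].
have hf : form (1 + a * K) (fun y : 'rV[k]_a =>
    y 0 j * shifted_monomial K (fun=> 0) y + (-1) * (y 0 i0 * shifted_monomial K e y)).
  apply: form_add; [|apply: form_scale]; apply: form_mul; try exact: form_coord.
    by apply: form_shifted_monomial => //; rewrite big1.
  exact: form_shifted_monomial.
have val y : torus y ->
    y 0 j * shifted_monomial K (fun=> 0) y + (-1) * (y 0 i0 * shifted_monomial K e y)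
    = (\prod_l y 0 l) ^+ K * (y 0 j - y 0 i0 * tpow (E *m B) y 0 j).
  move=> hy; rewrite !shifted_monomialE // [in RHS]mxE.
  have -> : \prod_b y 0 b ^ (0 : int) = 1 by rewrite big1 // => l _; rewrite expr0z.
  rewrite mulr1.
  by rewrite mulN1r mulrBr mulrC [in X in _ - X]mulrCA.
have := zclosure_form hf _ zx; rewrite val //= => h.
have /eqP : (\prod_l x 0 l) ^+ K * (x 0 j - x 0 i0 * tpow (E *m B) x 0 j) = 0.
  apply: h => _ [t ht ->]; rewrite val; last exact: tpow_torus.
  by rewrite -tpowM // -mulmxA BE mulmx1 (tpow_zero_row _ E0) mul1r subrr mulr0.
rewrite mulf_eq0 expf_eq0 (negbTE (torus_prod hx)) andbF /= subr_eq0.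
by move/eqP.
Qed.

(** The form [f'] has for coefficients the p-th powers of those of [f]. *)
Lemma frobenius_form p (hp : p \in [pchar k]) r d (f : 'rV[k]_r -> k) : form d f ->
  exists2 f', form d f' & forall v : 'rV[k]_r, f' (\row_i (v 0 i ^+ p)) = f v ^+ p.
Proof.
move=> [F hF fF].
pose h m (x : 'rV[k]_r) : k := F@_m ^+ p * \prod_i x 0 i ^+ m i.
have hh m : m \in msupp F -> form d (h m).
  move=> mF; apply: form_scale.
  have <- : (\sum_i m i)%N = d by rewrite -mdegE; apply: (dhomogP _ _ _ hF _ mF).
  apply: form_prod => i; rewrite -[X in form X]mul1n; apply: form_exp.
  exact: form_coord.
exists (fun x => \sum_(m <- msupp F | m \in msupp F) h m x); first exact: form_sum.
move=> v; rewrite fF mevalE -[RHS](pFrobenius_autE hp) rmorph_sum -big_seq.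
apply: eq_bigr => m _ /=; rewrite pFrobenius_autE exprMn; congr (_ * _).
rewrite -prodrXl; apply: eq_bigr => i _; by rewrite mxE -!exprM mulnC.
Qed.

End ShiftedMonomials.

(** * The toric variety of an integer matrix *)

Section ToricOfMatrix.
Variable k : closedFieldType.

Lemma toric_rows N m (E : 'M[int]_(N.+1, m)) :
  eq_pset (toric (k := k) (fun i => row i E)) (zclosure (torus_orbit E)).
Proof.
have := @toric_orbit k _ _ idfun _ (fun i => row i E) (Bijective (g := id) (frefl _) (frefl _)).
by rewrite (_ : \matrix_(i, j) _ = E) //; apply/matrixP => i j; rewrite !mxE.
Qed.

Lemma toric_of_matrix q (X : pset k q) a m (E : 'M[int]_(a, m)) (i0 : 'I_a) :
  closed X -> distinct_rows E -> linearly_equivalent X (zclosure (torus_orbit E)) ->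
  projectively_embedded_toric X.
Proof.
move=> cX inj e; split.
  split=> //; apply: linearly_equivalent_variety (linearly_equivalent_sym e) _ => //.
  split; first exact: zclosure_closed.
  apply: irreducible_zclosure; last exact: irreducible_torus_orbit i0.
  by move=> x; apply: (torus_orbit_nz i0).
case: a => [|a] in E i0 inj e *; first by case: i0.
exists 'rV[int]_m, a, (fun i => row i E); split=> //.
  exists m, idfun; exact: (Bijective (g := id)).
apply: lin_projectively_equivalent; apply: linearly_equivalent_trans e (linearly_equivalent_sym _).
exact/linearly_equivalent_eq/toric_rows.
Qed.

End ToricOfMatrix.

(** * The image of the Gauss map *)

Section GaussImage.
Variables (k : closedFieldType) (p : nat).
Hypothesis hp : p \in [pchar k].
Variables (n N R' : nat).
Local Notation R := R'.+1.
Variables (u : 'M[int]_n) (C : 'M[int]_(N.+1, n)).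
Variables (G : 'M[k]_(N.+1, R)) (H : 'M[k]_(R, N.+1)).
Hypothesis hu : (\det u)%:~R != 0 :> k.
Hypothesis C0 : row 0 C = 0.
Hypothesis GH : G *m H = 1%:M.

Local Notation X := (frob_variety p u C G).
Local Notation xi := (base_coord p C G).
Local Notation point := (frob_point p u C G).
Local Notation PL := (pluecker_mx k n R).
Local Notation PLinv := (pluecker_inv k n R).

Definition image_points : pset k (pluecker_size n.+1 (n + R)) :=
  fun w => exists2 s, torus s & w = xi s *m PL.

Lemma gauss_map_point s c : torus s -> c != 0 -> gauss_map n X (point s) (c *: (xi s *m PL)).
Proof.
move=> hs c0; exists (join_space n (xi s)); split; first exact: (gauss_frob_point hp hu C0 GH hs).
have x0 : xi s != 0 by apply: (base_coord_neq0 p C0 GH).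
have [c1 c10 ->] := pluecker_join x0 (fun v => proj1 (mem_join_space v _)) (dim_join_space n x0).
exists (c / c1); first by rewrite mulf_neq0 ?invr_eq0.
by rewrite scalerA divfK.
Qed.

Lemma gauss_mapP x w : gauss_map n X x w ->
  exists d (mu : 'rV[k]_(n + R) -> 'rV[k]_R),
  [/\ forall j, form d (fun z => mu z 0 j),
      forall s, torus s -> exists c, mu (point s) = c *: xi s,
      mu x != 0 /\ (exists2 c, c != 0 & w = c *: (mu x *m PL)) &
      exists c, rsubmx x = c *: mu x].
Proof.
move=> [U [gU [c c0 ->]]]; have [hx hU dU] := gU.
have [d [mu [h1 h2 h3 h4]]] := gauss_local hp hu C0 GH gU.
exists d, mu; split=> //; last first.
  apply/h4/hU => F hF; have [[e he] hF'] := hF.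
  by apply: (differential_euler he); apply: hF'.
split=> //; have [c1 c10 ->] := pluecker_join h2 (fun v => proj1 (h4 v)) dU.
by exists (c * c1); rewrite ?mulf_neq0 // scalerA.
Qed.

Lemma pluecker_neq0 (v : 'rV[k]_R) c : v != 0 -> c != 0 -> c *: (v *m PL) != 0.
Proof.
move=> v0 c0; rewrite scaler_eq0 negb_or c0; apply: contraNneq v0 => h.
by rewrite -[v]mulmx1 -(pluecker_mxK k n R) mulmxA h mul0mx.
Qed.

(** A form that vanishes on the values of the Gauss map on the torus pulls back
    along [mu] of [gauss_local] to a form vanishing on the whole variety, hence
    also at the given smooth point. *)
Lemma gauss_image_closure : eq_pset (zclosure (gauss_image n X)) (zclosure image_points).
Proof.
move=> w; split; last first.
  apply: zclosure_sub => _ [s hs ->]; exists (point s).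
  by have := gauss_map_point hs (oner_neq0 k); rewrite scale1r.
apply: zclosure_min; first exact: zclosure_closed.
move=> w' [x /[dup] hw /gauss_mapP[d [mu [hmu mus [mx [c c0 ->]] _]]]].
apply/zclosureP; split; first exact: pluecker_neq0.
move=> e f hf fi.
have hm : form (d * e) (fun z => f (mu z *m PL)) by apply: (form_comp (form_pull PL hf)).
rewrite (form_homogeneous _ _ hf); have [U [[hx _ _] _]] := hw.
rewrite (zclosure_form hm _ hx) ?mulr0 // => _ [s hs ->].
have [c' ->] := mus s hs; rewrite -scalemxAl (form_homogeneous _ _ hf) fi ?mulr0 //.
by exists s.
Qed.

Lemma frob_variety_equiv :
  linearly_equivalent X (zclosure (torus_orbit (col_mx u (p%:Z *: C)))).
Proof.
apply: (linearly_equivalent_zclosure (G := block_mx 1%:M 0 0 H) (H := block_mx 1%:M 0 0 G)).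
  move=> _ [s hs ->].
  rewrite /frob_point !mul_row_block !mulmx1 !mulmx0 !addr0 !add0r base_coordK //.
  by split=> //; exists s => //; rewrite tpow_col_mx.
move=> _ [s hs ->]; rewrite tpow_col_mx !mul_row_block !mulmx1 !mulmx0 !addr0 !add0r.
by split; [exists s|rewrite -mulmxA GH mulmx1].
Qed.

(** Modulo [p] the rows of [u] are independent, whereas those of [p C] are zero. *)
Lemma frob_variety_rows_inj : distinct_rows C -> distinct_rows (col_mx u (p%:Z *: C)).
Proof.
move=> Cinj.
have p0 : p%:R = 0 :> k by apply: pcharf0.
have p1 : (0 < p)%N := p_gt0 hp.
have det0 (M : 'M[int]_n) : \det M = 0 -> (\det M)%:~R = 0 :> k by move=> ->.
have hinj (i j : 'I_n) : row i u = row j u -> i = j.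
  move=> /rowP e; apply: NNPP => /eqP ij; case/eqP: hu; apply: det0.
  by apply: (determinant_alternate ij) => l; have := e l; rewrite !mxE.
have hno (i : 'I_n) (j : 'I_N.+1) : row i u <> row j (p%:Z *: C).
  move=> /rowP e; case/eqP: hu; rewrite (expand_det_row _ i) rmorph_sum big1 // => l _.
  have := e l; rewrite !mxE rmorphM /= => ->.
  by rewrite intrM -pmulrn p0 !mul0r.
have hC (i j : 'I_N.+1) : row i (p%:Z *: C) = row j (p%:Z *: C) -> i = j.
  move=> /rowP e; apply: Cinj; apply/rowP => l; have := e l; rewrite !mxE.
  by apply: mulfI; rewrite -lt0n in p1 *; case: (p) p1.
have ru i : row (lshift N.+1 i) (col_mx u (p%:Z *: C)) = row i u.
  by rewrite rowKu.
have rd i : row (rshift n i) (col_mx u (p%:Z *: C)) = row i (p%:Z *: C).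
  by rewrite rowKd.
move=> a b; rewrite -[a]splitK -[b]splitK.
case: (split a) => i; case: (split b) => j; rewrite /= ?ru ?rd.
- by move=> /hinj ->.
- by move=> /hno.
- by move=> /esym/hno.
- by move=> /hC ->.
Qed.

Lemma frob_variety_dim : has_dim X n.
Proof.
apply: (linearly_equivalent_dim _ _ (linearly_equivalent_sym frob_variety_equiv));
  try exact: zclosure_closed.
apply: (@dim_torus_orbit _ _ _ _ (rshift n 0) (lshift N.+1)).
  by rewrite rowKd linearZ /= C0 scaler0.
have -> : rowsub (lshift N.+1) (col_mx u (p%:Z *: C)) = u.
  by apply/matrixP => i j; rewrite mxE col_mxEu.
by apply: contraNneq hu => ->.
Qed.

Lemma frob_variety_toric : distinct_rows C -> projectively_embedded_toric X.
Proof.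
move=> Cinj; apply: (toric_of_matrix (rshift n 0) _ (frob_variety_rows_inj Cinj)
  frob_variety_equiv).
exact: zclosure_closed.
Qed.

End GaussImage.

(** * The general fiber of the Gauss map *)

Section Fibers.
Variables (k : closedFieldType) (p : nat).
Hypothesis hp : p \in [pchar k].
Variables (r1 r2 N R' : nat).
Local Notation R := R'.+1.
Local Notation n := (r1 + r2)%N.
Variables (u : 'M[int]_n) (C : 'M[int]_(N.+1, r2)) (B : 'M[int]_(r2, N.+1)).
Variables (G : 'M[k]_(N.+1, R)) (H : 'M[k]_(R, N.+1)).
Hypothesis hu : (\det u)%:~R != 0 :> k.
Hypothesis C0 : row 0 C = 0.
Hypothesis BC : B *m C = 1%:M.
Hypothesis B1 : B *m const_mx 1 = 0 :> 'cV_r2.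
Hypothesis GH : G *m H = 1%:M.

Local Notation Cn := (row_mx (0 : 'M[int]_(N.+1, r1)) C).
Local Notation X := (frob_variety p u Cn G).
Local Notation xi := (base_coord p Cn G).
Local Notation xibar := (toric_coord (k:=k) p Cn).
Local Notation point := (frob_point p u Cn G).
Local Notation PL := (pluecker_mx k n R).
Local Notation PLinv := (pluecker_inv k n R).

Lemma Cn0 : row 0 Cn = 0.
Proof. by rewrite row_row_mx C0 row0 row_mx0. Qed.

Definition frob m (s : 'rV[k]_m) : 'rV[k]_m := \row_j (s 0 j ^+ p).

Lemma frob_torus m (s : 'rV[k]_m) : torus s -> torus (frob s).
Proof. by move=> hs j; rewrite mxE expf_neq0. Qed.

Lemma frob_surj m (t : 'rV[k]_m) : torus t -> exists2 s, torus s & frob s = t.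
Proof.
move=> ht; have h j : exists x : k, x ^+ p = t 0 j by apply: root_exists; apply: p_gt0 hp.
have [s hs] := fin_all_exists h; exists (\row_j s j).
  move=> j; rewrite mxE; apply: contraNneq (ht j) => s0.
  by rewrite -hs s0 expr0n (gtn_eqF (p_gt0 hp)).
by apply/rowP => j; rewrite !mxE.
Qed.

Lemma toric_coord_row s1 s2 : xibar (row_mx s1 s2) = tpow C (frob s2).
Proof.
apply/rowP => j; rewrite /toric_coord scale_row_mx scaler0 tpow_row_mx tpow_natmul tpow_exp.
by rewrite (tpow_zero_row s1) ?row0 ?mul1r.
Qed.

Lemma torus_row_mx (s1 : 'rV[k]_r1) (s2 : 'rV[k]_r2) : torus s1 -> torus s2 -> torus (row_mx s1 s2).
Proof.
by move=> h1 h2 i; rewrite -[i]splitK; case: (split i) => j; rewrite /= ?row_mxEl ?row_mxEr.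
Qed.

Lemma torus_one m : torus (const_mx 1 : 'rV[k]_m).
Proof. by move=> i; rewrite mxE oner_neq0. Qed.

Lemma torus_lsub (s : 'rV[k]_n) : torus s -> torus (lsubmx s).
Proof. by move=> h i; rewrite mxE. Qed.

Lemma torus_rsub (s : 'rV[k]_n) : torus s -> torus (rsubmx s).
Proof. by move=> h i; rewrite mxE. Qed.

Lemma image_chart s : xi s *m PL *m (PLinv *m H) = tpow C (frob (rsubmx s)).
Proof.
rewrite mulmxA -[_ *m PLinv]mulmxA pluecker_mxK mulmx1 base_coordK //.
by rewrite -[s in LHS]hsubmxK toric_coord_row.
Qed.

Lemma base_coord_rsub s : xi s = tpow C (frob (rsubmx s)) *m G.
Proof. by rewrite -[s in LHS]hsubmxK /base_coord toric_coord_row. Qed.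

(** The p-th power map is surjective on tori, so multiplying the exponents by
    [p] does not change the orbit. *)
Lemma image_equiv :
  linearly_equivalent (zclosure (image_points p Cn G)) (zclosure (torus_orbit (k := k) C)).
Proof.
apply: (linearly_equivalent_zclosure (G := PLinv *m H) (H := G *m PL)).
  move=> _ [s hs ->]; rewrite image_chart; split.
    by exists (frob (rsubmx s)) => //; apply/frob_torus/torus_rsub.
  by rewrite mulmxA -base_coord_rsub.
move=> _ [t ht ->]; have [s hs <-] := frob_surj ht.
have -> : tpow C (frob s) *m (G *m PL) = xi (row_mx (const_mx 1) s) *m PL.
  by rewrite mulmxA base_coord_rsub row_mxKr.
split; last by rewrite image_chart row_mxKr.
by exists (row_mx (const_mx 1) s) => //; apply: torus_row_mx => //; apply: torus_one.
Qed.

(** The orbit of the first subtorus: the parameters [s1] vary and the second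
    block of coordinates stays fixed. *)
Definition fiber_points (s2 : 'rV[k]_r2) : pset k (n + R) :=
  fun x => exists2 s1, torus s1 & x = point (row_mx s1 s2).

Section FiberEquation.
Variables (s2 : 'rV[k]_r2) (mu : 'rV[k]_(n + R) -> 'rV[k]_R) (d : nat).
Hypothesis hs2 : torus s2.
Hypothesis hmu : forall j, form d (fun z => mu z 0 j).

Let T := rsubmx u *m B.
Let K := exponent_bound T.
Let kappa := tpow (rsubmx u) s2.
Let s0 := row_mx (const_mx 1 : 'rV[k]_r1) s2.
Let mubar z := mu z *m H.

(** Let [z] be the point of parameters [(s1', s2')]. To move it to the
    parameters [(s1', s2)], its i-th coordinate has to be multiplied by a
    Laurent monomial in the entries of [s2 / s2']. The p-th power of that
    monomial is also a Laurent monomial, of exponents [- T i], in the toric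
    coordinates of the second block of [z], hence in those of [mu z]. This gives
    p-th powers of the coordinates of the moved point as forms in [z], up to a
    common factor. *)
Definition fiber_lift (z : 'rV[k]_(n + R)) : 'rV[k]_(n + R) :=
  row_mx (\row_i (lsubmx z 0 i ^+ p * shifted_monomial K (fun l => - T i l) (mubar z)
                  * kappa 0 i ^+ p))
         (\row_j (((rsubmx z *m H) 0 0) ^+ p * shifted_monomial K (fun=> 0) (mubar z)
                  * xi s0 0 j ^+ p)).

Lemma T_bound i l : (`|(- T i l)%R| <= K)%N.
Proof. by rewrite abszN exponent_bound_le. Qed.

Lemma T_sum i : \sum_l (- T i l) = 0.
Proof.
have /colP/(_ i) : T *m const_mx 1 = 0 :> 'cV_n by rewrite -mulmxA B1 mulmx0.
rewrite [RHS]mxE mxE => h; rewrite sumrN; apply/eqP; rewrite oppr_eq0; apply/eqP.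
by rewrite -[RHS]h; apply: eq_bigr => l _; rewrite [const_mx _ _ _]mxE mulr1.
Qed.

Lemma form_mubar j : form d (fun z => mubar z 0 j).
Proof.
by rewrite -[d]muln1; apply: (form_comp (form_lin H j)).
Qed.

Lemma form_fiber_lift b :
  form (p + d * (N.+1 * K)) (fun z => fiber_lift z 0 b).
Proof.
have hl : form p (fun z : 'rV[k]_(n + R) => ((rsubmx z *m H) 0 0) ^+ p).
  rewrite -[p in form p]mul1n; apply: form_exp.
  apply: (@form_ext _ _ _ (fun z : 'rV[k]_(n + R) => (z *m col_mx 0 H) 0 0)).
    by move=> z; rewrite -[z in LHS]hsubmxK mul_row_col mulmx0 add0r.
  exact: form_lin.
rewrite -[b]splitK; case: (split b) => i /=.
  apply: (@form_ext _ _ _ (fun z : 'rV[k]_(n + R) =>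
    kappa 0 i ^+ p * (z 0 (lshift R i) ^+ p * shifted_monomial K (fun l => - T i l) (mubar z)))).
    move=> z; rewrite row_mxEl [RHS]mxE mulrC; congr (_ ^+ p * _ * _).
    by rewrite mxE.
  apply: form_scale; apply: form_mul.
    by rewrite -[p in form p]mul1n; apply/form_exp/form_coord.
  apply: form_comp form_mubar; apply: form_shifted_monomial; [exact: T_bound|exact: T_sum].
apply: (@form_ext _ _ _ (fun z : 'rV[k]_(n + R) =>
    xi s0 0 i ^+ p * (((rsubmx z *m H) 0 0) ^+ p * shifted_monomial K (fun=> 0) (mubar z)))).
  by move=> z; rewrite row_mxEr [RHS]mxE mulrC.
apply: form_scale; apply: form_mul => //.
by apply: form_comp form_mubar; apply: form_shifted_monomial; rewrite ?big1.
Qed.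

(** The point moved to the second parameter [s2], when [z] has second parameter
    [s2'] and its second block is [a] times the normalized one. *)
Definition slide (s2' : 'rV[k]_r2) (z : 'rV[k]_(n + R)) a : 'rV[k]_(n + R) :=
  row_mx (\row_i (lsubmx z 0 i * (kappa 0 i / tpow (rsubmx u) s2' 0 i))) (a *: xi s0).

Lemma fiber_liftE s1' s2' z a c : torus s1' -> torus s2' ->
  mu z = c *: xi (row_mx s1' s2') -> rsubmx z = a *: xi (row_mx s1' s2') ->
  fiber_lift z = (c ^+ (N.+1 * K) * (\prod_l tpow C (frob s2') 0 l) ^+ K)
     *: frob (slide s2' z a).
Proof.
move=> h1 h2 hm hz.
have tC : torus (tpow C (frob s2')) by apply/tpow_torus/frob_torus.
have mb : mubar z = c *: tpow C (frob s2').
  by rewrite /mubar hm -scalemxAl base_coordK // toric_coord_row.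
have zH : (rsubmx z *m H) 0 0 = a.
  by rewrite hz -scalemxAl base_coordK // mxE toric_coord0 ?mulr1 // Cn0.
have K0 : forall l : 'I_N.+1, (`|(0 : int)| <= K)%N by [].
have hf0 := @form_shifted_monomial k N.+1 K (fun=> 0) K0 (big1 _ _ _ (fun _ _ => erefl)).
apply/rowP => b; rewrite [RHS]mxE [frob _ 0 b]mxE -[b]splitK; case: (split b) => i /=.
  rewrite /fiber_lift /slide !row_mxEl mxE [in RHS]mxE mb.
  rewrite (form_homogeneous _ _ (form_shifted_monomial k (T_bound i) (T_sum i))).
  rewrite shifted_monomialE //; last exact: T_bound.
  have -> : \prod_l tpow C (frob s2') 0 l ^ (- T i l) = (tpow (rsubmx u) s2' 0 i ^+ p)^-1.
    rewrite -tpow_exp -/(frob s2') -[rsubmx u in RHS]mulmx1 -BC mulmxA -/T.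
    rewrite tpowM; last exact: frob_torus.
    rewrite [X in X^-1]mxE -prodfV; apply: eq_bigr => l _.
    by rewrite invr_expz.
  rewrite !exprMn exprVn -!mulrA [_ * (c ^+ _ * _)]mulrCA; congr (_ * _).
  rewrite [LHS]mulrCA; congr (_ * _); congr (_ * _); exact: mulrC.
rewrite /fiber_lift /slide !row_mxEr mxE [in RHS]mxE mb zH.
rewrite (form_homogeneous _ _ hf0) shifted_monomialE //.
rewrite [\prod_b _ ^ 0]big1 ?mulr1 => [|l _]; last by rewrite expr0z.
by rewrite exprMn -!mulrA [LHS]mulrCA; congr (_ * _); rewrite mulrCA.
Qed.

Lemma frob_point_row (s1 : 'rV[k]_r1) (s2' : 'rV[k]_r2) i : tpow u (row_mx s1 s2') 0 i =
  tpow (lsubmx u) s1 0 i * tpow (rsubmx u) s2' 0 i.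
Proof. by rewrite -tpow_row_mx hsubmxK. Qed.

Lemma slide_point s1' s2' : torus s1' -> torus s2' ->
  slide s2' (point (row_mx s1' s2')) 1 = point (row_mx s1' s2).
Proof.
move=> h1 h2; rewrite /slide scale1r /frob_point /base_coord !toric_coord_row; congr row_mx.
apply/rowP => i; rewrite row_mxKl mxE !frob_point_row -mulrA; congr (_ * _).
by rewrite mulrCA divff ?mulr1 //; apply: tpow_torus.
Qed.

End FiberEquation.

(** Let [f] vanish on the orbit and let [x] be any smooth point with the given
    tangent space, possibly outside the torus. Then [f] to the power [p],
    evaluated at the moved point, is a form in the original one, see
    [fiber_lift]; it vanishes on the torus, hence at [x]. But [mu x] is
    proportional to the second block of the orbit, so [x] is moved to itself and
    [f x = 0]. *)
Lemma gauss_fiber_closure s2 c : torus s2 -> c != 0 ->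
  eq_pset (zclosure (gauss_fiber n X (c *: (xi (row_mx (const_mx 1) s2) *m PL))))
          (zclosure (fiber_points s2)).
Proof.
move=> hs2 c0 x0; set s0 := row_mx (const_mx 1) s2.
have xis s1 : xi (row_mx s1 s2) = xi s0 by rewrite /base_coord !toric_coord_row.
have hs0 : torus s0 by apply: torus_row_mx => //; apply: torus_one.
split; last first.
  apply: zclosure_sub => _ [s1 hs1 ->]; rewrite /gauss_fiber -(xis s1).
  exact: (gauss_map_point hp hu Cn0 GH (torus_row_mx hs1 hs2) c0).
apply: zclosure_min; first exact: zclosure_closed.
move=> x hw; have [U [[hx _ _] _]] := hw.
have [d [mu [hmu mus [mx [c1 c10 ew]] [a ea]]]] := gauss_mapP hp hu Cn0 GH hw.
have muE : mu x = (c1^-1 * c) *: xi s0.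
  have := congr1 (mulmx^~ PLinv) ew; rewrite -!scalemxAl -!mulmxA pluecker_mxK !mulmx1.
  by move=> e; rewrite -scalerA e scalerA mulVf // scale1r.
have e0 : c1^-1 * c != 0 by rewrite mulf_neq0 ?invr_eq0.
apply/zclosureP; split; first exact: zclosure_nz hx.
move=> e f hf ff; have [f' hf' f'E] := frobenius_form hp hf.
have hm : form ((p + d * (N.+1 * exponent_bound (rsubmx u *m B))) * e)
    (fun z => f' (fiber_lift s2 mu z)).
  by apply: (form_comp hf') => b; apply: form_fiber_lift.
have : f' (fiber_lift s2 mu x) = 0.
  apply: (zclosure_form hm _ hx) => _ [s hs ->].
  (* At a point of the torus, the moved point lies on the orbit. *)
  have [c' hc'] := mus s hs; rewrite -[s]hsubmxK in hc' *.
  have h1 := torus_lsub hs; have h2 := torus_rsub hs.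
  rewrite (fiber_liftE s2 (a := 1) h1 h2 hc'); last by rewrite row_mxKr scale1r.
  rewrite (form_homogeneous _ _ hf') f'E slide_point // ff ?expr0n ?(gtn_eqF (p_gt0 hp)) ?mulr0 //.
  by exists (lsubmx s).
rewrite (fiber_liftE s2 (a := a * (c1^-1 * c)) (@torus_one r1) hs2 muE);
  last by rewrite ea muE scalerA.
rewrite (form_homogeneous _ _ hf') f'E.
(* The point [x] is not moved, and the common factor is nonzero. *)
have -> : slide s2 s2 x (a * (c1^-1 * c)) = x.
  rewrite -[RHS]hsubmxK /slide; congr row_mx; last by rewrite ea muE scalerA.
  apply/rowP => i; rewrite mxE divff ?mulr1 //; exact: tpow_torus.
have tC : \prod_l tpow C (frob s2) 0 l != 0 by apply/torus_prod/tpow_torus/frob_torus.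
move/eqP; rewrite mulf_eq0 !expf_eq0 mulf_eq0 !expf_eq0 (negbTE e0) (negbTE tC) !andbF /=.
by move/andP => [_ /eqP].
Qed.

(** Where no toric coordinate vanishes, a point of the closed image lies in the
    image of the torus, by [open_orbit]. *)
Lemma general_gauss_value w : zclosure (gauss_image n X) w ->
  (forall j, (w *m (PLinv *m H)) 0 j != 0) ->
  exists c s2, [/\ c != 0, torus s2 & w = c *: (xi (row_mx (const_mx 1) s2) *m PL)].
Proof.
move=> /(gauss_image_closure hp hu Cn0 GH) hw hne.
pose x := w *m (PLinv *m H).
have lw : forall y, image_points p Cn G y -> y *m (PLinv *m H) *m (G *m PL) = y.
  move=> _ [s hs ->].
  by rewrite image_chart mulmxA -base_coord_rsub.
have hx : zclosure (torus_orbit C) x /\ x *m (G *m PL) = w.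
  have sub : forall y, image_points p Cn G y -> torus_orbit C (y *m (PLinv *m H)).
    move=> _ [s hs ->]; rewrite image_chart; exists (frob (rsubmx s)) => //.
    exact/frob_torus/torus_rsub.
  split.
    apply/zclosureP; split.
      by apply: contraNneq (hne 0) => x0; rewrite -/x x0 mxE.
    move=> e f hf fC; apply: (zclosure_form (form_pull (PLinv *m H) hf) _ hw) => y /sub.
    exact: fC.
  apply/rowP => j; apply/eqP; rewrite -subr_eq0; apply/eqP.
  have hf : form 1 (fun y : 'rV[k]_(pluecker_size n.+1 (n + R)) =>
      (y *m (PLinv *m H *m (G *m PL))) 0 j + (-1) * y 0 j).
    by apply: form_add; [exact: form_lin|apply/form_scale/form_coord].
  have : (w *m (PLinv *m H *m (G *m PL))) 0 j + (-1) * w 0 j = 0.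
    apply: (zclosure_form hf _ hw) => y /lw e.
    by rewrite mulmxA e mulN1r subrr.
  by rewrite mulmxA mulN1r.
have [c [t [c0 ht xE]]] := open_orbit C0 BC B1 (proj1 hx) hne.
have [s2 hs2 st] := frob_surj ht; exists c, s2; split=> //.
by rewrite -(proj2 hx) xE -st -scalemxAl mulmxA base_coord_rsub row_mxKr.
Qed.

End Fibers.

(** * The closed fiber as a toric variety *)

Section FiberEquiv.
Variables (k : closedFieldType) (p : nat).
Hypothesis hp : p \in [pchar k].
Variables (r1 r2 N R' M : nat).
Local Notation R := R'.+1.
Local Notation n := (r1 + r2)%N.
Variables (u : 'M[int]_n) (C : 'M[int]_(N.+1, r2)).
Variables (G : 'M[k]_(N.+1, R)) (H : 'M[k]_(R, N.+1)).
Hypothesis C0 : row 0 C = 0.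
Hypothesis GH : G *m H = 1%:M.
Variables (A : 'M[int]_(M.+1, r1)) (sigma : 'I_n -> 'I_M.+1).
Hypothesis A0 : row 0 A = 0.
Hypothesis uA : lsubmx u = rowsub sigma A.
Hypothesis sigma_onto : forall a, a != 0 -> exists i, sigma i = a.

Local Notation Cn := (row_mx (0 : 'M[int]_(N.+1, r1)) C).

(** On an orbit of the first subtorus, the coordinates of the first block are
    constant multiples of the monomials of [A], each nontrivial one occurring,
    and the second block is a constant vector multiplied by the trivial
    monomial. *)
Lemma fiber_equiv s2 : torus s2 ->
  linearly_equivalent (zclosure (fiber_points p u C G s2)) (zclosure (torus_orbit (k := k) A)).
Proof.
move=> hs2; pose kappa := tpow (rsubmx u) s2.
have kappa0 : torus kappa by apply: tpow_torus.
pose xi0 := base_coord p Cn G (row_mx (const_mx 1) s2).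
have xis s1 : base_coord p Cn G (row_mx s1 s2) = xi0 by rewrite /xi0 !base_coord_rsub !row_mxKr.
have xiH : (xi0 *m H) 0 0 = 1.
  by rewrite /xi0 base_coordK // toric_coord0 // row_row_mx C0 row0 row_mx0.
(* An index of the first block where the monomial [a] occurs; the trivial
   monomial is read off from the second block instead. *)
have /fin_all_exists[tau htau] : forall a, exists i : 'I_n + unit,
    match i with inl i => sigma i = a | inr _ => a = 0 end.
  move=> a; have [->|/sigma_onto[i si]] := eqVneq a 0; first by exists (inr tt).
  by exists (inl i).
pose P : 'M[k]_(M.+1, n + R) := row_mx (\matrix_(a, i) ((a == sigma i)%:R * kappa 0 i))
   (\matrix_(a, j) ((a == 0)%:R * xi0 0 j)).
pose Q : 'M[k]_(n + R, M.+1) := \matrix_(b, a)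
  match tau a, split b with
  | inl i, inl i' => (i' == i)%:R / kappa 0 i
  | inr _, inr j => H j 0
  | _, _ => 0 end.
have Ql a i' : Q (lshift R i') a =
    if tau a is inl i then (i' == i)%:R / kappa 0 i else 0.
  by rewrite mxE (unsplitK (inl i')).
have Qr a j : Q (rshift n j) a = if tau a is inr _ then H j 0 else 0.
  by rewrite mxE (unsplitK (inr j)); case: (tau a).
have PE s1 : tpow A s1 *m P = frob_point p u Cn G (row_mx s1 s2).
  rewrite mul_mx_row /frob_point xis; congr row_mx; apply/rowP => i; rewrite mxE.
    rewrite (bigD1 (sigma i)) //= big1 ?addr0 => [|a ai]; rewrite mxE.
      by rewrite eqxx mul1r frob_point_row uA tpow_rowsub.
    by rewrite (negbTE ai) mul0r mulr0.
  rewrite (bigD1 0) //= big1 ?addr0 => [|a ai]; rewrite mxE.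
    by rewrite eqxx mul1r tpow_zero_row // mul1r.
  by rewrite (negbTE ai) mul0r mulr0.
have QE s1 : frob_point p u Cn G (row_mx s1 s2) *m Q = tpow A s1.
  apply/rowP => a; rewrite mxE big_split_ord /=; have := htau a.
  case e: (tau a) => [i|[]] ha.
    rewrite [X in _ + X]big1 ?addr0 => [|j _]; last by rewrite Qr e mulr0.
    rewrite (bigD1 i) //= big1 ?addr0 => [|j ji]; rewrite Ql e /frob_point row_mxEl.
      by rewrite eqxx mul1r frob_point_row uA tpow_rowsub ha mulfK //; apply: kappa0.
    by rewrite (negbTE ji) mul0r mulr0.
  rewrite big1 ?add0r => [|j _]; last by rewrite Ql e mulr0.
  rewrite {}ha in e *; rewrite tpow_zero_row // -xiH mxE; apply: eq_bigr => j _.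
  by rewrite Qr e /frob_point row_mxEr xis.
apply: (linearly_equivalent_zclosure (G := Q) (H := P)).
  by move=> _ [s1 hs1 ->]; rewrite QE PE; split=> //; exists s1.
by move=> _ [s1 hs1 ->]; rewrite PE QE; split=> //; exists s1.
Qed.

End FiberEquiv.

(** * Choice of the exponents *)

Lemma selection M r1 r2 (g : 'I_r1 -> 'I_M.+1) : injective g -> (forall i, g i != 0) ->
  (M <= r1 + r2)%N ->
  exists sigma : 'I_(r1 + r2) -> 'I_M.+1, (forall i, sigma (lshift r2 i) = g i) /\
    forall a, a != 0 -> exists i, sigma i = a.
Proof.
move=> ginj g0 Mle; pose S := [set a | (a != 0) && (a \notin codom g)].
pose sigma (i : 'I_(r1 + r2)) := match split i with inl i => g i | inr j => nth 0 (enum S) j end.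
exists sigma; split=> [i|a a0]; first by rewrite /sigma (unsplitK (inl i)).
pose T := 0 |: [set g i | i : 'I_r1].
have cT : #|T| = r1.+1.
  rewrite cardsU1 card_imset // card_ord.
  have /negbTE-> // : 0 \notin [set g i | i : 'I_r1].
  by apply/imsetP => -[i _ /esym/eqP]; rewrite (negbTE (g0 i)).
have ST : S = ~: T.
  apply/setP => b; rewrite !inE negb_or; congr (_ && ~~ _).
  by apply/codomP/imsetP => [[i ->]|[i _ ->]]; exists i.
have cS : (#|S| <= r2)%N.
  by rewrite ST; have := cardsC T; rewrite cT card_ord; lia.
have [/codomP[i ->]|nc] := boolP (a \in codom g).
  by exists (lshift r2 i); rewrite /sigma (unsplitK (inl i)).
(* The remaining indices occupy the second block, filled up with the index 0. *)
have aS : a \in enum S by rewrite mem_enum inE a0.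
have idx : (index a (enum S) < r2)%N.
  by apply: leq_trans cS; rewrite cardE index_mem.
exists (rshift r1 (Ordinal idx)).
by rewrite /sigma (unsplitK (inr (Ordinal idx))) /= nth_index.
Qed.

(** The square matrix [u] has the rows [(a_i, 0)], for a maximal minor of [A]
    invertible in [k], and [(a_j, e_j)] for [r2] further rows of [A]; the latter
    include all the remaining nonzero rows, which is where the bound on [M]
    enters. It is block triangular with an identity block. *)
Lemma minor_choice (k : closedFieldType) M r1 r2 (A : 'M[int]_(M.+1, r1)) (B : 'M[int]_(r1, M.+1)) :
  row 0 A = 0 -> B *m A = 1%:M -> (M <= r1 + r2)%N ->
  exists (u : 'M[int]_(r1 + r2)) (sigma : 'I_(r1 + r2) -> 'I_M.+1),
  [/\ (\det u)%:~R != 0 :> k, lsubmx u = rowsub sigma A &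
      forall a, a != 0 -> exists i, sigma i = a].
Proof.
move=> A0 BA le; have [g ginj gdet] := full_rank_minor k BA.
have g0 i : g i != 0.
  apply: contraNneq gdet => gi; rewrite (expand_det_row _ i) big1 // => j _.
  by move/rowP: A0 => /(_ j); rewrite !mxE gi => ->; rewrite mul0r.
have [sigma [sl so]] := selection ginj g0 le.
pose V := rowsub (sigma \o @rshift r1 r2) A.
exists (block_mx (rowsub g A) 0 V 1%:M), sigma; split=> //.
  by rewrite det_lblock det1 mulr1.
apply/matrixP => i j; rewrite -[i]splitK; case: (split i) => l /=.
  by rewrite [LHS]mxE block_mxEul !mxE sl.
by rewrite [LHS]mxE block_mxEdl !mxE.
Qed.

(** * Realization of given fibers and images *)

(** The general values of the Gauss map are those at which no toric coordinate
    vanishes. *)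
Lemma gauss_fiber_image_realized (k : closedFieldType) (p : nat) (hp : p \in [pchar k])
    (N' N'' : nat) (Y : pset k N'.+1) (Z : pset k N''.+1) (dY dZ : nat)
    (hY : projectively_embedded_toric Y) (hZ : projectively_embedded_toric Z)
    (hdY : has_dim Y dY) (hdZ : has_dim Z dZ) (hN : (N' <= dY + dZ)%N) :
  exists X : pset k (dY + dZ + N''.+1),
    [/\ projectively_embedded_toric X,
        has_dim X (dY + dZ),
        for_general_point (zclosure (gauss_image (dY + dZ) X))
          (fun w => projectively_equivalent (zclosure (gauss_fiber (dY + dZ) X w)) Y) &
        projectively_equivalent (zclosure (gauss_image (dY + dZ) X)) Z].
Proof.
have [M [r1 [A [B [GA [HA [[A0 Ainj BA _] GHA YA1 YA2]]]]]]] := toric_normal_form hY.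
have [N [r2 [C [B' [G [H [[C0 Cinj BC B1] GH ZC1 ZC2]]]]]]] := toric_normal_form hZ.
have normal_dim r q (E : 'M[int]_(q.+1, r)) (F : 'M[int]_(r, q.+1)) :
    row 0 E = 0 -> F *m E = 1%:M -> has_dim (zclosure (torus_orbit (k := k) E)) r.
  move=> E0 FE; have [g _ gdet] := full_rank_minor k FE.
  by apply: (@dim_torus_orbit _ _ _ _ 0 g) => //; apply: contraNneq gdet => ->.
have eY : linearly_equivalent (zclosure (torus_orbit A)) Y.
  exists GA, HA; split=> [x hx|y Yy]; last exact: YA2.
  by split; [exact: YA1|rewrite -mulmxA GHA mulmx1].
have eZ : linearly_equivalent (zclosure (torus_orbit C)) Z.
  exists G, H; split=> [x hx|y Yy]; last exact: ZC2.
  by split; [exact: ZC1|rewrite -mulmxA GH mulmx1].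
have [[cY _] _] := hY; have [[cZ _] _] := hZ.
have cl q (S : pset k q) := zclosure_closed S.
have ? : dY = r1.
  exact: (has_dim_uniq hdY (linearly_equivalent_dim (cl _ _) cY eY (normal_dim _ _ _ _ A0 BA))).
have ? : dZ = r2.
  exact: (has_dim_uniq hdZ (linearly_equivalent_dim (cl _ _) cZ eZ (normal_dim _ _ _ _ C0 BC))).
subst dY dZ.
have MN : (M <= r1 + r2)%N.
  have := rank_leq_col GA; have /eqP -> := row_free_retraction GHA.
  by rewrite ltnS => /leq_trans; apply.
have [u [sigma [hu uA so]]] := minor_choice k A0 BA MN.
pose Cn := row_mx (0 : 'M[int]_(N.+1, r1)) C.
have Cn0 : row 0 Cn = 0 by exact: Cn0.
have Cninj : distinct_rows Cn.
  move=> i j; rewrite !row_row_mx => e; apply: Cinj.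
  by have := congr1 rsubmx e; rewrite !row_mxKr.
have img := gauss_image_closure hp hu Cn0 GH.
exists (frob_variety p u Cn G); split.
- exact: (frob_variety_toric hp hu GH Cninj).
- exact: (frob_variety_dim p hu Cn0 GH).
- pose chart := pluecker_inv k (r1 + r2) N''.+1 *m H.
  have hf : form (\sum_(j < N.+1) 1) (fun w => \prod_j (w *m chart) 0 j).
    by apply: form_prod => j; apply: form_lin.
  exists (fun w => w != 0 /\ \prod_j (w *m chart) 0 j = 0); split.
  + exact: (closed_form hf).
  + pose s : 'rV[k]_(r1 + r2) := const_mx 1.
    have hs : torus s by apply: torus_one.
    pose w := base_coord p Cn G s *m pluecker_mx k (r1 + r2) N''.+1.
    have w0 : w != 0.
      by rewrite -[w]scale1r pluecker_neq0 ?oner_neq0 //; apply: (base_coord_neq0 p Cn0 GH).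
    exists w; first by apply/img; apply: sub_zclosure => //; exists s.
    move=> [_ /eqP]; rewrite /w /chart (image_chart p _ GH); apply/negP.
    by apply/torus_prod/tpow_torus/frob_torus/torus_rsub.
  move=> w hw nC.
  have [|c [s2 [c0 hs2 ->]]] := general_gauss_value hp hu C0 BC B1 GH hw.
    move=> j; apply/eqP => hj; apply: nC; split; first exact: zclosure_nz hw.
    by rewrite (bigD1 j) //= hj mul0r.
  apply: lin_projectively_equivalent; apply: linearly_equivalent_trans eY.
  have fe := fiber_equiv p C0 GH A0 uA so hs2.
  apply: linearly_equivalent_trans fe.
  exact/linearly_equivalent_eq/(gauss_fiber_closure hp hu C0 BC B1 GH hs2 c0).
apply: lin_projectively_equivalent; apply: linearly_equivalent_trans eZ.
have ie : linearly_equivalent (zclosure (image_points p Cn G)) (zclosure (torus_orbit C)).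
  exact: (image_equiv hp r1 C GH).
exact: (linearly_equivalent_trans (linearly_equivalent_eq img) ie).
Qed.

Theorem theorem1p4 (k : closedFieldType) (p : nat) (hp : p \in [pchar k])
    (N' N'' : nat) (Y : pset k N'.+1) (Z : pset k N''.+1) (dY dZ n : nat)
    (hY : projectively_embedded_toric Y) (hZ : projectively_embedded_toric Z)
    (hdY : has_dim Y dY) (hdZ : has_dim Z dZ)
    (hn : n = (dY + dZ)%N) (hN : (N' <= n)%N) :
  exists X : pset k (n + N'').+1,
    [/\ projectively_embedded_toric X,
        has_dim X n,
        for_general_point (zclosure (gauss_image n X))
          (fun w => projectively_equivalent (zclosure (gauss_fiber n X w)) Y) &
        projectively_equivalent (zclosure (gauss_image n X)) Z].
Proof.
subst n; rewrite -addnS; exact: (gauss_fiber_image_realized hp hY hZ hdY hdZ hN).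
Qed.
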